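(* Consider the discrete-time plant $(A,B,C,D)$ and the exosystem $(S,E,F)$ described in the context, and assume that the following conditions hold (notation $A^\pm,B^\pm,C^\pm,\Pi,\mathbf{G}$ as in the context): (a1) $e^{i\theta_\ell}\in\varrho(A)$ for every $\ell\in\{1,\dots,n\}$; (a2) $\det\mathbf{G}(e^{i\theta_\ell})\neq 0$ for every $\ell\in\{1,\dots,n\}$; (a3) there exist closed subspaces $X^+$ and $X^-$ of $X$ such that $\dim X^+<\infty$ and $X=X^+\oplus X^-$; (a4) $AX^+\subset X^+$ and $AX^-\subset X^-$; (a5) $\sigma(A)\cap \mathrm{cl}(\mathbb{E}_1)$ consists of finitely many eigenvalues with finite algebraic multiplicities, $\sigma(A^+)=\sigma(A)\cap\mathrm{cl}(\mathbb{E}_1)$, and there exists $\eta_0\in(0,1)$ such that $\sigma(A^-)=\sigma(A)\cap(\mathbb{C}\setminus\mathrm{cl}(\mathbb{E}_{\eta_0}))$; (a6) $(A^+,B^+,C^+)$ is controllable and observable; (a7) the zeros of $\det(zI-A^+)$ are simple. Then there exists a finite-dimensional controller $(P,Q,R)$ (i.e. one with $\dim X_{\rm d}<\infty$) that is a solution of the robust output regulation problem for discrete-time systems defined in the context.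
   Context: Notation: $\mathbb{E}_\eta=\{z\in\mathbb{C}:|z|>\eta\}$; $\mathrm{cl}$ denotes closure; $\sigma$, $\varrho$ denote spectrum and resolvent set; $\mathbb{Z}_+$ is the set of nonnegative integers. $T\in\mathcal{L}(Y)$ is power stable if there are $\Gamma\ge1$, $\rho\in(0,1)$ with $\|T^k\|\le\Gamma\rho^k$ for all $k\in\mathbb{Z}_+$. Plant: $x(k+1)=Ax(k)+Bu(k)$, $x(0)=x^0\in X$, $y(k)=Cx(k)+Du(k)$, where $X$ is a separable complex Hilbert space, $A\in\mathcal{L}(X)$, $B\in\mathcal{L}(\mathbb{C}^p,X)$, $C\in\mathcal{L}(X,\mathbb{C}^p)$, $D\in\mathbb{C}^{p\times p}$. Controller (strictly causal): $x_{\rm d}(k+1)=Px_{\rm d}(k)+Qu_{\rm d}(k)$, $x_{\rm d}(0)=x_{\rm d}^0\in X_{\rm d}$, $y_{\rm d}(k)=Rx_{\rm d}(k)$, where $X_{\rm d}$ is a complex Hilbert space, $P\in\mathcal{L}(X_{\rm d})$, $Q\in\mathcal{L}(\mathbb{C}^p,X_{\rm d})$, $R\in\mathcal{L}(X_{\rm d},\mathbb{C}^p)$. Exosystem: $\xi(k+1)=S\xi(k)$, $\xi(0)=\xi^0\in\mathbb{C}^n$, $v(k)=E\xi(k)$, $y_{\rm ref}(k)=F\xi(k)$, where $E,F\in\mathbb{C}^{p\times n}$ and $S=\mathrm{diag}(e^{i\theta_1},\dots,e^{i\theta_n})$ with $\theta_1,\dots,\theta_n\in[0,2\pi)$ distinct.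 Interconnection: $u(k)=y_{\rm d}(k)+v(k)$ and $u_{\rm d}(k)=e(k):=y_{\rm ref}(k)-y(k)$. The closed-loop operator on $X\times X_{\rm d}$ is $A_{\rm e}=\begin{bmatrix} A & BR \\ -QC & P-QDR \end{bmatrix}$. Set of perturbations: $\mathcal{O}(P,Q,R)$ is the set of all $(\widetilde A,\widetilde B,\widetilde C,\widetilde D,\widetilde E,\widetilde F)$ with $\widetilde A\in\mathcal{L}(X)$, $\widetilde B\in\mathcal{L}(\mathbb{C}^p,X)$, $\widetilde C\in\mathcal{L}(X,\mathbb{C}^p)$, $\widetilde D\in\mathbb{C}^{p\times p}$, $\widetilde E,\widetilde F\in\mathbb{C}^{p\times n}$ such that $\widetilde A_{\rm e}=\begin{bmatrix} \widetilde A & \widetilde BR \\ -Q\widetilde C & P-Q\widetilde DR \end{bmatrix}$ is power stable. Robust output regulation problem for discrete-time systems: given the plant and the exosystem, find a controller $(P,Q,R)$ such that (Stability) $A_{\rm e}$ is power stable; (Tracking) there exist $M_e>0$ and $\rho_e\in(0,1)$ such that for all $x^0\in X$, $x_{\rm d}^0\in X_{\rm d}$, $\xi^0\in\mathbb{C}^n$ one has $\|e(k)\|_{\mathbb{C}^p}\le M_e\rho_e^k\left(\left\|\begin{bmatrix} x^0 \\ x_{\rm d}^0 \end{bmatrix}\right\|_{X\times X_{\rm d}}+\|\xi^0\|_{\mathbb{C}^n}\right)$ for all $k\in\mathbb{Z}_+$; (Robustness) if $(A,B,C,D,E,F)$ is changed to any $(\widetilde A,\widetilde B,\widetilde C,\widetilde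 D,\widetilde E,\widetilde F)\in\mathcal{O}(P,Q,R)$, then the tracking condition still holds. Decomposition: with $\Pi$ the projection of $X$ onto $X^+$ along $X^-$, $A^+=A|_{X^+}$, $B^+=\Pi B$, $C^+=C|_{X^+}$, $A^-=A|_{X^-}$, $B^-=(I-\Pi)B$, $C^-=C|_{X^-}$. Transfer function: for a fixed $\eta\in(\eta_0,1)$, $\mathbf{G}(z)=C(zI-A)^{-1}B+D$ for $z\in\mathbb{E}_\eta\cap\varrho(A)$. *)

(* Defs.v *)
From HB Require Import structures.
From mathcomp Require Import all_boot all_order all_algebra.
From mathcomp Require Import complex.
From mathcomp Require Import all_classical all_reals all_analysis.
Import Order.TTheory GRing.Theory Num.Theory numFieldNormedType.Exports.

Set Implicit Arguments.
Unset Strict Implicit.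
Unset Printing Implicit Defensive.

Local Open Scope classical_set_scope.
Local Open Scope ring_scope.
Local Open Scope complex_scope.

(* A complex Hilbert space is a complete normed space over R[i] whose norm
   comes from an inner product (linear in the first argument). *)
HB.mixin Record CompleteNormedModule_isHilbert (R : realType) V
    & CompleteNormedModule R[i] V := {
  inner : {dot V for Num.conj};
  sqr_norm_inner : forall x : V, `|x| ^+ 2 = inner x x
}.

#[short(type="hilbertType")]
HB.structure Definition Hilbert (R : realType) :=
  {V of CompleteNormedModule R[i] V & CompleteNormedModule_isHilbert R V}.

Definition separable (T : topologicalType) :=
  exists D : set T, countable D /\ dense D.

(* L(X, Y).  With Y := 'cV_p the topology is that of the sup norm, which is the
   Euclidean one; Euclidean norms are used explicitly below where a norm on C^p
   appears in an estimate. *)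
Record bounded_op (R : realType) (X Y : normedModType R[i]) := BoundedOp {
  bop :> {linear X -> Y};
  bop_continuous : continuous bop
}.

Section Norms.
Variable R : realType.

(* `|x| lives in R[i]; its imaginary part vanishes *)
Definition rnorm (X : normedModType R[i]) (x : X) : R := complex.Re `|x|.

Definition euclid_norm (p : nat) (v : 'cV[R[i]]_p) : R :=
  Num.sqrt (\sum_i complex.Re `|v i 0| ^+ 2).

(* The Hilbert norm of X x Y (the library norm on the product is the max). *)
Definition pair_norm (X Y : normedModType R[i]) (z : X * Y) : R :=
  Num.sqrt (rnorm z.1 ^+ 2 + rnorm z.2 ^+ 2).

(* The operator norm; sup is a junk value unless T is bounded for nrm. *)
Definition opnorm (Y : Type) (nrm : Y -> R) (T : Y -> Y) : R :=
  sup [set nrm (T y) | y in [set y | nrm y <= 1]].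

Definition power_stable (Y : Type) (nrm : Y -> R) (T : Y -> Y) :=
  exists Gamma rho : R, [/\ 1 <= Gamma, 0 < rho < 1 &
    forall k : nat, opnorm nrm (iter k T) <= Gamma * rho ^+ k].

End Norms.

Section Subspaces.
Variables (R : realType) (X : normedModType R[i]).
Implicit Types V W : set X.

Definition closed_subspace V := GRing.submod_closed (mem V) /\ closed V.

Definition direct_sum V W :=
  (forall x : X, exists v w, [/\ V v, W w & x = v + w]) /\
  (forall x : X, V x -> W x -> x = 0).

(* the projection onto V along W, when the space is the direct sum V + W *)
Definition proj_along V W (x : X) : X := xget 0 [set v | V v /\ W (x - v)].

Definition is_basis V (m : nat) (b : 'I_m -> X) :=
  (forall c : 'I_m -> R[i], \sum_i c i *: b i = 0 -> forall i, c i = 0) /\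
  V = [set x | exists c : 'I_m -> R[i], x = \sum_i c i *: b i].

Definition finite_dim V := exists (m : nat) (b : 'I_m -> X), is_basis V b.

Definition maps_into_self (T : X -> X) V := forall x, V x -> V (T x).

(* q = det(zI - T|_V), computed in a basis of the finite-dimensional space V *)
Definition is_char_poly V (T : X -> X) (q : {poly R[i]}) :=
  exists (m : nat) (b : 'I_m -> X) (M : 'M[R[i]]_m),
    [/\ is_basis V b, (forall j, T (b j) = \sum_i M i j *: b i) &
        q = char_poly M].

End Subspaces.

Definition simple_zeros (K : fieldType) (q : {poly K}) :=
  forall z, root q z -> mup z q = 1%N.

Section Spectrum.
Variables (R : realType) (X : normedModType R[i]).

(* Resolvent set and spectrum of the restriction T|_V : V -> V to a T-invariant
   subspace V; a bounded operator on V is encoded by a function on X of which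
   only the values on V matter. *)
Definition resolvent_set_on (V : set X) (T : X -> X) : set R[i] :=
  [set z | exists S : X -> X,
    [/\ maps_into_self S V,
        (forall a, {in V &, forall x y, S (a *: x + y) = a *: S x + S y}),
        (exists M : R, forall x, V x -> rnorm (S x) <= M * rnorm x),
        (forall x, V x -> S (z *: x - T x) = x) &
        (forall x, V x -> z *: S x - T (S x) = x)]].

Definition spectrum_on V T : set R[i] := ~` resolvent_set_on V T.

Definition resolvent_set T := resolvent_set_on setT T.
Definition spectrum T := spectrum_on setT T.

(* (zI - T)^-1, for z in the resolvent set of T *)
Definition resolvent (T : X -> X) (z : R[i]) (x : X) : X :=
  xget 0 [set y | z *: y - T y = x].

Definition is_eigenvalue (T : X -> X) (z : R[i]) :=
  exists2 x : X, x != 0 & T x = z *: x.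

(* The algebraic multiplicity of z is the dimension of this space. *)
Definition gen_eigenspace (T : X -> X) (z : R[i]) : set X :=
  [set x | exists k, iter k (fun y => z *: y - T y) x = 0].

Definition finite_alg_mult T z := finite_dim (gen_eigenspace T z).

End Spectrum.

(* E_eta, in R[i] with the topology of its modulus *)
Definition exterior (R : realType) (eta : R) : set (R[i])^o :=
  [set z : R[i] | eta%:C < `|z|].

Definition expi (R : realType) (t : R) : R[i] := cos t +i* sin t.

Section LinearSystems.
Variables (R : realType) (X : normedModType R[i]) (p : nat).
Implicit Types (A : X -> X) (B : 'cV[R[i]]_p -> X) (C : X -> 'cV[R[i]]_p).

(* controllability and observability of a system with state space V *)
Definition controllable (V : set X) A B :=
  forall x0 x1, V x0 -> V x1 ->
  exists (N : nat) (x : nat -> X) (u : nat -> 'cV[R[i]]_p),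
    [/\ x 0%N = x0, (forall k, x k.+1 = A (x k) + B (u k)) & x N = x1].

Definition observable (V : set X) A C :=
  forall x0 x1, V x0 -> V x1 ->
  (forall k, C (iter k A x0) = C (iter k A x1)) -> x0 = x1.

End LinearSystems.

(* The plant (A, B, C, D) together with the output matrices E, F of the
   exosystem: the data subject to perturbation. *)
Record plant (R : realType) (X : normedModType R[i]) (p n : nat) := Plant {
  plA : bounded_op X X;
  plB : bounded_op 'cV[R[i]]_p X;
  plC : bounded_op X 'cV[R[i]]_p;
  plD : 'M[R[i]]_p;
  plE : 'M[R[i]]_(p, n);
  plF : 'M[R[i]]_(p, n)
}.

Record controller (R : realType) (Xd : normedModType R[i]) (p : nat) :=
  Controller {
  ctP : bounded_op Xd Xd;
  ctQ : bounded_op 'cV[R[i]]_p Xd;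
  ctR : bounded_op Xd 'cV[R[i]]_p
}.

(* G(z) = C (zI - A)^-1 B + D, for z in the resolvent set of A *)
Definition transfer (R : realType) (X : normedModType R[i]) (p n : nat)
    (G : plant X p n) (z : R[i]) : 'M[R[i]]_p :=
  (\matrix_(i, j) plC G (resolvent (plA G) z (plB G (delta_mx j 0))) i 0)
  + plD G.

Definition exosystem_mx (R : realType) (n : nat) (theta : 'I_n -> R) :
    'M[R[i]]_n :=
  diag_mx (\row_l expi (theta l)).

Section ClosedLoop.
Variables (R : realType) (X Xd : normedModType R[i]) (p n : nat).
Implicit Types (G : plant X p n) (K : controller Xd p) (S : 'M[R[i]]_n).

Definition closed_loop_op G K (z : X * Xd) : X * Xd :=
  (plA G z.1 + plB G (ctR K z.2),
   - ctQ K (plC G z.1) + (ctP K z.2 - ctQ K (plD G *m ctR K z.2))).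

Definition closed_loop_stable G K :=
  power_stable (@pair_norm R X Xd) (closed_loop_op G K).

Record closed_loop_signals G K S (x : nat -> X) (xd : nat -> Xd)
    (xi : nat -> 'cV[R[i]]_n) (u y ud yd v yref e : nat -> 'cV[R[i]]_p) :
    Prop := ClosedLoopSignals {
  plant_state : forall k, x k.+1 = plA G (x k) + plB G (u k);
  plant_output : forall k, y k = plC G (x k) + plD G *m u k;
  controller_state : forall k, xd k.+1 = ctP K (xd k) + ctQ K (ud k);
  controller_output : forall k, yd k = ctR K (xd k);
  exosystem_state : forall k, xi k.+1 = S *m xi k;
  disturbance : forall k, v k = plE G *m xi k;
  reference : forall k, yref k = plF G *m xi k;
  plant_input : forall k, u k = yd k + v k;
  tracking_error : forall k, e k = yref k - y k;
  controller_input : forall k, ud k = e k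
}.

(* the initial data (x^0, xd^0, xi^0) are the values at time 0 *)
Definition tracking G K S :=
  exists Me rhoe : R, [/\ 0 < Me, 0 < rhoe < 1 &
    forall x xd xi u y ud yd v yref e,
      closed_loop_signals G K S x xd xi u y ud yd v yref e ->
      forall k, euclid_norm (e k) <=
        Me * rhoe ^+ k * (pair_norm (x 0%N, xd 0%N) + euclid_norm (xi 0%N))].

(* the set O(P, Q, R) *)
Definition admissible_perturbations K : set (plant X p n) :=
  [set G' | closed_loop_stable G' K].

Definition solves_robust_regulation G K S :=
  [/\ closed_loop_stable G K, tracking G K S &
      forall G', admissible_perturbations K G' -> tracking G' K S].

End ClosedLoop.

(* Main.v *)
Require Import Defs.
From HB Require Import structures.
From mathcomp Require Import all_boot all_order all_algebra.
From mathcomp Require Import complex.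
From mathcomp Require Import ring lra zify.
From mathcomp Require Import all_classical all_reals all_analysis.
Import Order.TTheory GRing.Theory Num.Theory numFieldNormedType.Exports.

(** The plant is split as x = x+ + x-, with x+ in the finite-dimensional
    unstable part and x- in the stable part, and A-, B-, C- are the
    corresponding restrictions.  The controller has three components:

    - an estimate of x+, updated as in a Luenberger observer;
    - an internal model: for each exosystem eigenvalue lam_l a vector q_l in C^p
      with q_l(k+1) = lam_l q_l(k) + e(k), where e is the tracking error;
    - a shift register holding the last N+1 values of its own output u.

    The register stands in for an observer of x-, which would be
    infinite-dimensional.  It yields the approximation sum_(j <= N) A-^j B- u(k-1-j) of x-,
    whose error zeta satisfies zeta(k+1) = A- zeta(k) + A-^(N+1) B- u(k-N-1).
    As A- is power stable, the coupling A-^(N+1) B- is geometrically small in N.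

    Stability.  Put v_l = q_l - C (lam_l - A)^-1 x.  Then
    v_l(k+1) = lam_l v_l(k) - G(lam_l) u(k), so that x+ and the v_l form a
    finite-dimensional system driven by u, in which the stable part does not
    appear.  It is controllable: the lam_l are distinct, they are not eigenvalues
    of A+, the matrices G(lam_l) are invertible, and (A+, B+) is controllable.
    A deadbeat feedback for it ([deadbeat_modal_feedback]) and a deadbeat
    observer for x+ ([deadbeat_observer]) give a closed loop that is block
    triangular in (x+, v), the observer error and zeta, except for the
    coupling above, which closes the loop through the register.  Neither the
    feedback nor the observer gain depends on N, so that a weighted sum of
    adapted norms contracts once N is large ([lyapunov_weights],
    [loop_decay]).

    Power stability of A- comes from its spectrum by an elementary form of the
    spectral radius formula ([spectral_decay]): resolvents of the powers
    T^(2^k) are averages of resolvents of T, hence Lipschitz along rays with a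
    constant independent of k, and smallness of T^(2^k) / r^(2^k) propagates
    from large radii r down to a radius smaller than 1.

    Regulation.  If the closed loop is power stable, every unimodular lam is in
    its resolvent set, so that each exosystem mode has a steady state, towards
    which the closed loop converges exponentially.  In the steady state at
    frequency lam_l the internal model reads lam_l q_l = lam_l q_l + e, whence
    e = 0.  This uses nothing of the plant beyond stability of the closed
    loop, and therefore also holds after an admissible perturbation
    ([internal_model_tracking]). *)

Set Implicit Arguments.
Unset Strict Implicit.
Unset Printing Implicit Defensive.
Local Open Scope classical_set_scope.
Local Open Scope ring_scope.

(** * Equations in abelian groups, by reflection *)

Section AbelianGroupReflection.
Variable V : zmodType.

(** Formal integer combinations of atoms; two of them with equal coefficients
    have equal values in every abelian group. *)
Inductive zexpr :=
  | ZVar of nat | ZAdd of zexpr & zexpr | ZOpp of zexpr | ZZero.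

Fixpoint zeval (env : seq V) e : V :=
  match e with
  | ZVar i => nth 0 env i
  | ZAdd a b => zeval env a + zeval env b
  | ZOpp a => - zeval env a
  | ZZero => 0
  end.

Fixpoint zcoef e i : int :=
  match e with
  | ZVar j => (i == j)%:Z
  | ZAdd a b => zcoef a i + zcoef b i
  | ZOpp a => - zcoef a i
  | ZZero => 0
  end.

Lemma zevalE env e :
  zeval env e = \sum_(i < size env) nth 0 env i *~ zcoef e i.
Proof.
elim: e => [j|a IHa b IHb|a IHa|] /=; rewrite ?IHa ?IHb.
- case: (ltnP j (size env)) => hj; last first.
    rewrite nth_default // big1 // => i _.
    by rewrite [_ == _](_ : _ = false) ?mulr0z // ltn_eqF // (leq_trans (ltn_ord i)).
  rewrite (bigD1 (Ordinal hj)) //= eqxx mulr1z big1 ?addr0 // => i ij.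
  by rewrite [_ == _](_ : _ = false) ?mulr0z //; apply: negbTE.
- by rewrite -big_split; apply: eq_bigr => i _; rewrite mulrzDr.
- by rewrite -sumrN; apply: eq_bigr => i _; rewrite mulrNz.
- by rewrite big1.
Qed.

Lemma zeval_eq env a b :
  all (fun i => zcoef a i == zcoef b i) (iota 0 (size env)) ->
  zeval env a = zeval env b.
Proof.
move=> /allP h; rewrite !zevalE; apply: eq_bigr => i _.
by rewrite (eqP (h i _)) // mem_iota ltn_ord.
Qed.
End AbelianGroupReflection.

(* Atoms are compared up to conversion, so that two canonical-structure
   presentations of the same term are identified. *)
Ltac zsame x y :=
  match constr:(Set) with
  | _ => let _ := match constr:(Set) with _ => constr_eq x y end in constr:(true)
  | _ => let _ := match constr:(Set) with _ => unify x y end in constr:(true)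
  | _ => constr:(false)
  end.
Ltac zindex x env :=
  match env with
  | ?y :: ?env' =>
      let b := zsame x y in
      match b with
      | true => constr:(0%N)
      | false => let i := zindex x env' in constr:(S i)
      end
  end.
Ltac zinsert x env0 env :=
  match env with
  | nil => constr:(cons x env0)
  | ?y :: ?env' =>
      let b := zsame x y in
      match b with
      | true => env0
      | false => zinsert x env0 env'
      end
  end.
Ltac zatoms t env :=
  match t with
  | @GRing.add _ ?a ?b => let env' := zatoms a env in zatoms b env'
  | @GRing.opp _ ?a => zatoms a env
  | @GRing.zero _ => env
  | _ => zinsert t env env
  end.
Ltac zquote t env :=
  match t with
  | @GRing.add _ ?a ?b =>
      let a' := zquote a env in let b' := zquote b env in constr:(ZAdd a' b')
  | @GRing.opp _ ?a => let a' := zquote a env in constr:(ZOpp a')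
  | @GRing.zero _ => constr:(ZZero)
  | _ => let i := zindex t env in constr:(ZVar i)
  end.
(** Proves identities of abelian groups; scalar multiples and values of
    functions count as atoms, so linear maps must be expanded beforehand. *)
Ltac abel :=
  match goal with
  | |- @eq ?T ?a ?b =>
    let env := zatoms a constr:(@nil T) in
    let env := zatoms b env in
    let a' := zquote a env in let b' := zquote b env in
    exact: (@zeval_eq _ env a' b' isT)
  end.

(** * Moduli of complex numbers, seminorms, bounded operators *)

Section Modulus.
Variable R : realType.
Implicit Types (z : R[i]) (t : R).

Definition cmod z : R := complex.Re `|z|.

Lemma cmodE z : `|z| = ((cmod z)%:C)%C. Proof. by rewrite /cmod normc_def. Qed.
Lemma cmod_ge0 z : 0 <= cmod z. Proof. by rewrite -ler0c -cmodE normr_ge0. Qed.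
Lemma cmodM z1 z2 : cmod (z1 * z2) = cmod z1 * cmod z2.
Proof. exact: Normc.normcM. Qed.
Lemma cmodD z1 z2 : cmod (z1 + z2) <= cmod z1 + cmod z2.
Proof. exact: le_normcD. Qed.
Lemma cmod0 : cmod 0 = 0. Proof. by rewrite /cmod normr0. Qed.
Lemma cmod1 : cmod 1 = 1. Proof. by rewrite /cmod normr1. Qed.
Lemma cmodN z : cmod (- z) = cmod z. Proof. by rewrite /cmod normrN. Qed.
Lemma cmod_eq0 z : cmod z = 0 -> z = 0. Proof. exact: Normc.eq0_normc. Qed.
Lemma cmodV z : cmod z^-1 = (cmod z)^-1. Proof. exact: Normc.normcV. Qed.
Lemma cmodX z n : cmod (z ^+ n) = cmod z ^+ n.
Proof. by elim: n => [|n IH]; rewrite ?expr0 ?cmod1 // !exprS cmodM IH. Qed.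
Lemma cmod_real t : 0 <= t -> cmod (t%:C)%C = t.
Proof. by move=> t0; rewrite /cmod ger0_norm ?ler0c. Qed.
Lemma cmod_dist z1 z2 : cmod (z1 - z2) = cmod (z2 - z1).
Proof. by rewrite -cmodN opprB. Qed.
Lemma cmod_leD (x y : R) : cmod (x +i* y)%C <= `|x| + `|y|.
Proof.
rewrite /cmod normc_def /=.
rewrite -(@ler_pXn2r _ 2) ?nnegrE ?sqrtr_ge0 ?addr_ge0 //.
rewrite sqr_sqrtr ?addr_ge0 ?sqr_ge0 // sqrrD !real_normK ?num_real //.
by have := mulr_ge0 (normr_ge0 x) (normr_ge0 y); lra.
Qed.
Lemma normRe_le z : `|complex.Re z| <= cmod z.
Proof. by rewrite -lecR -cmodE normc_ge_Re. Qed.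
Lemma normIm_le z : `|complex.Im z| <= cmod z.
Proof.
rewrite -[`|_|]sqrtr_sqr /cmod normc_def /=; apply: ler_wsqrtr.
by rewrite lerDr sqr_ge0.
Qed.

End Modulus.

Section Seminorm.
Variables (R : realType) (V : lmodType R[i]).

(** Estimates below are between real-valued seminorms on complex spaces; the
    library norm of a complex normed space takes its values in R[i]. *)
Record seminorm (q : V -> R) : Prop := Seminorm {
  sn_ge0 : forall x, 0 <= q x;
  sn_add : forall x y, q (x + y) <= q x + q y;
  sn_scale : forall a x, q (a *: x) = cmod a * q x }.

Variables (q : V -> R) (sq : seminorm q).

Lemma sn0 : q 0 = 0.
Proof. by rewrite -(scale0r 0) (sn_scale sq) cmod0 mul0r. Qed.
Lemma snN x : q (- x) = q x.
Proof. by rewrite -scaleN1r (sn_scale sq) cmodN cmod1 mul1r. Qed.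
Lemma sn_sub x y : q (x - y) <= q x + q y.
Proof. by rewrite -(snN y) (sn_add sq). Qed.
Lemma sn_sum (I : Type) (r : seq I) (P : pred I) (F : I -> V) :
  q (\sum_(i <- r | P i) F i) <= \sum_(i <- r | P i) q (F i).
Proof.
elim/big_rec2: _ => [|i y1 y2 _ H]; first by rewrite sn0.
by rewrite (le_trans (sn_add sq _ _)) // lerD2l.
Qed.
End Seminorm.

Section Rnorm.
Variables (R : realType) (X : normedModType R[i]).

Lemma rnormE (x : X) : `|x| = ((rnorm x)%:C)%C.
Proof.
rewrite /rnorm; have := normr_ge0 x; case: (`|x|) => a b.
by rewrite lecE /= => /andP[/eqP -> _].
Qed.
Lemma seminorm_rnorm : seminorm (@rnorm R X).
Proof.
split=> [x|x y|a x]; first by rewrite -ler0c -rnormE normr_ge0.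
  by rewrite -lecR rmorphD /= -!rnormE ler_normD.
by apply: complexI; rewrite rmorphM /= -cmodE -!rnormE normrZ.
Qed.
Lemma rnorm_eq0 (x : X) : rnorm x = 0 -> x = 0.
Proof. by move=> h; apply/normr0_eq0; rewrite rnormE h. Qed.
Lemma rnorm_ge0 (x : X) : 0 <= rnorm x. Proof. exact: sn_ge0 seminorm_rnorm x. Qed.
Lemma rnormD (x y : X) : rnorm (x + y) <= rnorm x + rnorm y.
Proof. exact: sn_add seminorm_rnorm x y. Qed.
Lemma rnormB (x y : X) : rnorm (x - y) <= rnorm x + rnorm y.
Proof. exact: sn_sub seminorm_rnorm x y. Qed.
Lemma rnormZ a (x : X) : rnorm (a *: x) = cmod a * rnorm x.
Proof. exact: sn_scale seminorm_rnorm a x. Qed.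
Lemma rnormN (x : X) : rnorm (- x) = rnorm x.
Proof. exact: snN seminorm_rnorm x. Qed.
Lemma rnorm0 : rnorm (0 : X) = 0. Proof. exact: sn0 seminorm_rnorm. Qed.

End Rnorm.

Section BoundedOps.
Variables (R : realType) (X Y : normedModType R[i]).

Lemma bop_bound (f : bounded_op X Y) :
  exists M : R, 0 < M /\ forall x, rnorm (f x) <= M * rnorm x.
Proof.
have /linear_boundedP fb :=
  continuous_linear_bounded 0 (@bop_continuous _ _ _ f 0).
have [r r0 fr] := pinfty_ex_gt0 fb.
have rE : r = ((cmod r)%:C)%C by rewrite -cmodE gtr0_norm.
exists (cmod r); split; first by rewrite -ltcR -rE.
by move=> x; rewrite -lecR rmorphM /= -!rnormE -rE.
Qed.

Lemma linear_bound_continuous (f : {linear X -> Y}) (M : R) :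
  (forall x, rnorm (f x) <= M * rnorm x) -> continuous f.
Proof.
move=> fM; apply: bounded_linear_continuous; apply/linear_boundedP.
exists ((Num.max M 0)%:C)%C; split; first by rewrite realE ler0c le_max lexx orbT.
move=> r Mr x; apply: (le_trans _ (ler_wpM2r (normr_ge0 x) (ltW Mr))).
rewrite !rnormE -rmorphM /= lecR (le_trans (fM x)) //.
by rewrite ler_wpM2r ?rnorm_ge0 // le_max lexx.
Qed.

End BoundedOps.

Section Disc.
Variable R : realType.
(** Heine-Borel on the square containing the disc: bounds that hold locally
    and persist when the constant grows hold uniformly. *)
Lemma uniform_on_disc (P : R -> R[i] -> Prop) (beta : R) :
  (forall C C' b, C <= C' -> P C b -> P C' b) ->
  (forall b, cmod b <= beta -> exists C delta, 0 < delta /\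
     forall b', cmod b' <= beta -> cmod (b' - b) < delta -> P C b') ->
  exists C, forall b, cmod b <= beta -> P C b.
Proof.
move=> Pmono Ploc.
pose K : set (R * R)%type := `[- beta, beta] `*` `[- beta, beta].
have cK : compact K by apply: compact_setX; apply: segment_compact.
have := (compact_near_coveringP K).1 cK R (+oo)
  (fun C z => cmod (z.1 +i* z.2)%C <= beta -> P C (z.1 +i* z.2)%C) _.
case=> [|C0 [_ hC]].
  move=> [x y] _.
  (* points outside the disc have a neighbourhood that misses it *)
  have [C [d [d0 H]]] : exists C delta, 0 < delta /\ forall b',
      cmod b' <= beta -> cmod (b' - (x +i* y)%C) < delta -> P C b'.
    have [le|gt] := lerP (cmod (x +i* y)%C) beta; first exact: Ploc.
    exists 0, (cmod (x +i* y)%C - beta); split; first by rewrite subr_gt0.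
    move=> b' b'b; rewrite cmod_dist => h; exfalso.
    have := cmodD ((x +i* y)%C - b') b'; rewrite subrK.
    by move: h b'b; lra.
  exists (ball x (d/2) `*` ball y (d/2), [set C' | C <= C']); first split=> /=.
  - exists (ball x (d/2), ball y (d/2)) => //=.
    by split; apply: nbhsx_ballx; lra.
  - by apply: nbhs_pinfty_ge; exact: num_real.
  move=> [[u v] C'] [[/= zx zy] CC'] le; apply: (Pmono C) => //.
  apply: H => //.
  have -> : (u +i* v - (x +i* y) = (u - x) +i* (v - y))%C by [].
  apply: le_lt_trans (cmod_leD _ _) _.
  by move: zx zy; rewrite /ball /= distrC => zx; rewrite distrC => zy; lra.
exists (C0 + 1) => b lb; case: b lb => x y lb.
have := hC (C0 + 1) _ (x, y) _ lb; apply; first lra.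
by split; rewrite /= in_itv /= -ler_norml;
   [have := normRe_le (x +i* y)%C | have := normIm_le (x +i* y)%C] => /= h;
   apply: le_trans h lb.
Qed.
End Disc.

(** * Spectral radius below one implies geometric decay *)

Section IterLinear.
Variables (R : pzRingType) (X : lmodType R) (T : {linear X -> X}).
Lemma iter_linearP n a x y : iter n T (a *: x + y) = a *: iter n T x + iter n T y.
Proof. by elim: n => //= n ->; rewrite linearP. Qed.
Lemma iter_linearD n x y : iter n T (x + y) = iter n T x + iter n T y.
Proof. by rewrite -[x in LHS]scale1r iter_linearP scale1r. Qed.
Lemma iter_linear0 n : iter n T 0 = 0.
Proof. by elim: n => //= n ->; rewrite linear0. Qed.
Lemma iter_linearZ n a x : iter n T (a *: x) = a *: iter n T x.
Proof. by rewrite -[a *: x]addr0 iter_linearP iter_linear0 addr0. Qed.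
Lemma iter_linearN n x : iter n T (- x) = - iter n T x.
Proof. by rewrite -scaleN1r iter_linearZ scaleN1r. Qed.
End IterLinear.

Lemma exprn_lt_eventually (R : realType) (s e : R) : 0 <= s < 1 -> 0 < e ->
  exists n0, forall n, (n0 <= n)%N -> s ^+ n < e.
Proof.
move=> /andP[s0 s1] e0.
have /cvgrPdist_lt/(_ e e0) : (fun n => s ^+ n : R^o) @ \oo --> (0 : R^o).
  by apply: cvg_expr; rewrite ger0_norm.
case=> n0 _ h; exists n0 => n /h /=.
by rewrite sub0r normrN ger0_norm // exprn_ge0.
Qed.

Lemma exprn_ge_eventually (R : realType) (s e : R) : 1 < s ->
  exists n, e <= s ^+ n.
Proof.
move=> s1; have s0 : 0 < s by lra.
have sV : 0 <= s^-1 < 1 by rewrite invr_ge0 ltW //= invf_lt1.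
have e0 : 0 < (Num.max e 1)^-1 by rewrite invr_gt0 lt_max ltr01 orbT.
have [n hn] := exprn_lt_eventually sV e0.
exists n; have := hn n (leqnn _).
rewrite exprVn ltf_pV2 ?posrE ?exprn_gt0 ?lt_max ?ltr01 ?orbT //.
by case/orP: (le_total e 1) => _ /ltW; apply: le_trans; rewrite le_max lexx.
Qed.

Section Dyadic.
Variables (R : realType) (X : normedModType R[i]) (V : set X).
Variables (T : {linear X -> X}) (tau beta C : R).
Hypothesis VP : forall a x y, V x -> V y -> V (a *: x + y).
Hypothesis V0 : V 0.
Hypothesis TV : maps_into_self T V.
Hypothesis Tb : forall x, rnorm (T x) <= tau * rnorm x.
Hypothesis C0 : 0 < C.
Hypothesis beta1 : 1 < beta.
Hypothesis tau0 : 0 <= tau.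
Hypothesis HC : forall b, cmod b <= beta ->
  forall x, V x -> rnorm x <= C * rnorm (x - b *: T x).
Hypothesis Hs : forall b, cmod b <= beta ->
  forall x, V x -> exists2 y, V y & y - b *: T y = x.

Local Notation pw n b x := (b ^+ n *: iter n T x).
Let K := C * (beta * (tau * C)).

Let VD x y : V x -> V y -> V (x + y).
Proof. by move=> Vx Vy; rewrite -[x]scale1r; exact: VP. Qed.
Let VZ a x : V x -> V (a *: x).
Proof. by move=> Vx; rewrite -[_ *: _]addr0; exact: VP. Qed.
Let iterV n x : V x -> V (iter n T x).
Proof. by move=> Vx; elim: n => //= n; exact: TV. Qed.
Let K0 : 0 <= K.
Proof.
have b0 : 0 <= beta by rewrite ltW // (lt_trans ltr01).
by rewrite /K !mulr_ge0 // ltW.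
Qed.

Let pwD n m b x : pw (n + m) b x = pw n b (pw m b x).
Proof. by rewrite iter_linearZ scalerA -exprD iterD. Qed.
Let pwDx n b x y : pw n b (x + y) = pw n b x + pw n b y.
Proof. by rewrite iter_linearD scalerDr. Qed.
Let pwZx n b a x : pw n b (a *: x) = a *: pw n b x.
Proof. by rewrite iter_linearZ !scalerA mulrC. Qed.
Let pwNx n b x : pw n b (- x) = - pw n b x.
Proof. by rewrite iter_linearN scalerN. Qed.

(** Turning b by such a z changes the sign of (b T)^(2^k), so that the inverse
    of 1 - (b T)^(2^(k+1)) is the mean of the inverses of 1 - (b T)^(2^k) and
    1 - (z b T)^(2^k).  This is why only powers of two are considered. *)
Lemma rootN1 k : exists z : R[i], cmod z = 1 /\ z ^+ (2 ^ k) = -1.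
Proof.
elim: k => [|k [z [z1 zk]]]; first by exists (-1); rewrite cmodN cmod1.
exists (sqrtc z); rewrite expnS exprM sqr_sqrtc; split=> //.
apply: (@pexpIrn _ 2) => //; rewrite ?nnegrE ?cmod_ge0 //.
by rewrite -cmodX sqr_sqrtc expr1n.
Qed.

Lemma dyadic_injective k b : cmod b <= beta -> forall x, V x ->
  x - pw (2 ^ k) b x = 0 -> x = 0.
Proof.
elim: k b => [|k IH] b bb x Vx.
  rewrite expr1 /= => h; apply: rnorm_eq0; apply/eqP.
  by rewrite eq_le rnorm_ge0 andbT (le_trans (HC bb Vx)) // h rnorm0 mulr0.
have [z [z1 zk]] := rootN1 k.
set n := (2 ^ k)%N in zk IH *; have -> : (2 ^ k.+1 = n + n)%N.
  by rewrite expnS mul2n addnn.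
move=> h; have zb : cmod (z * b) <= beta by rewrite cmodM z1 mul1r.
have : x - pw n (z * b) x = 0.
  apply: (IH b) => //.
    by rewrite -scaleNr addrC; apply: VP => //; exact: iterV.
  rewrite exprMn zk mulN1r scaleNr opprK pwDx -pwD -h.
  by rewrite opprD addrA addrK.
by apply: IH.
Qed.

(** The bound on y - y' is a Lipschitz estimate for the inverse of
    1 - (b T)^(2^k) along a ray.  Its constant does not depend on k: at k = 0 it
    is the resolvent identity, and averaging two inverses preserves it. *)
Lemma dyadic_resolvent k b t : cmod b <= beta -> 0 <= t <= 1 ->
  forall x, V x -> exists y y', [/\ V y /\ V y', y - pw (2 ^ k) b y = x,
    y' - pw (2 ^ k) ((t%:C)%C * b) y' = x &
    rnorm (y - y') <= K * (1 - t) * rnorm x].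
Proof.
move=> bb t01; elim: k b bb => [|k IH] b bb x Vx.
  rewrite !expr1 /=; case/andP: t01 => t0 t1.
  have tbb : cmod ((t%:C)%C * b) <= beta.
    by rewrite cmodM cmod_real // (le_trans _ bb) // ler_piMl // cmod_ge0.
  have [y Vy hy] := Hs bb Vx; have [y' Vy' hy'] := Hs tbb Vx.
  exists y, y'; split=> //.
  have Vyy : V (y - y') by rewrite -[y]scale1r -scaleN1r addrC; apply: VP => //; rewrite scale1r.
  have := HC bb Vyy.
  have -> : y - y' - b *: T (y - y') = (((1 - t)%:C)%C * b) *: T y'.
    rewrite linearB scalerBr opprD addrACA -opprD hy -{1}hy' opprB addrC subrKA.
    by rewrite rmorphB /= mulrBl mul1r scalerBl.
  rewrite rnormZ cmodM cmod_real ?subr_ge0 // => h; apply: (le_trans h).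
  have h1 : rnorm (T y') <= tau * (C * rnorm x).
    by apply: (le_trans (Tb _)); rewrite ler_wpM2l // -hy'; exact: HC.
  have : (1 - t) * cmod b * rnorm (T y') <= (1 - t) * beta * (tau * (C * rnorm x)).
    apply: ler_pM => //; rewrite ?mulr_ge0 ?subr_ge0 ?cmod_ge0 ?rnorm_ge0 //.
    by rewrite ler_wpM2l ?subr_ge0.
  move=> /(ler_wpM2l (ltW C0)) /le_trans; apply.
  by rewrite /K le_eqVlt; apply/orP; left; apply/eqP; ring.
have [z [z1 zk]] := rootN1 k.
set n := (2 ^ k)%N in zk IH *; have -> : (2 ^ k.+1 = n + n)%N.
  by rewrite expnS mul2n addnn.
have zb : cmod (z * b) <= beta by rewrite cmodM z1 mul1r.
have [y1 [y1' [[V1 V1'] h1 h1' d1]]] := IH b bb x Vx.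
have [y2 [y2' [[V2 V2'] h2 h2' d2]]] := IH (z * b) zb x Vx.
have avg c u v : u - pw n c u = x -> v - pw n (z * c) v = x ->
    2^-1 *: (u + v) - pw (n + n) c (2^-1 *: (u + v)) = x.
  rewrite exprMn zk mulN1r scaleNr opprK => hu hv.
  have Pu : pw n c u = u - x by rewrite -hu opprB addrC subrK.
  have Pv : pw n c v = x - v by rewrite -hv addrAC addrN add0r.
  have PP : pw (n + n) c (u + v) = u + v - 2 *: x.
    rewrite pwD pwDx Pu Pv addrA subrK pwDx pwNx Pu Pv opprB.
    by rewrite addrACA -opprD scaler_nat mulr2n [u + v]addrC [v + u]addrC addrAC.
  rewrite pwZx PP -scalerBr opprB.
  by rewrite addrC subrK scalerA mulVf ?scale1r // pnatr_eq0.
exists (2^-1 *: (y1 + y2)), (2^-1 *: (y1' + y2')); split.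
- by split; apply: VZ; apply: VD.
- exact: avg.
- by apply: avg => //; rewrite mulrCA.
rewrite -scalerBr opprD addrACA rnormZ cmodV.
have -> : cmod (2 : R[i]) = 2 by rewrite -[2 in LHS](rmorph_nat (real_complex R)) cmod_real.
by have := rnormD (y1 - y1') (y2 - y2'); lra.
Qed.

(** (s T)^(2^k) eventually has norm at most 1 on V; the aim is some s > 1. *)
Let bnd (s : R) := exists k0, forall k, (k0 <= k)%N ->
  forall x, V x -> s ^+ (2 ^ k) * rnorm (iter (2 ^ k) T x) <= rnorm x.

(** At sg * s the powers are small, so the inverse of 1 - (sg s T)^(2^k) is
    close to 1; the Lipschitz estimate keeps the inverse at s' within 1/2 of 1,
    which bounds (s' T)^(2^k). *)
Lemma dyadic_step s s' sg : 0 <= s -> s <= s' <= beta -> 0 < sg < 1 ->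
  K * (1 - sg * s / s') <= 6^-1 -> 0 < s' -> bnd s -> bnd s'.
Proof.
move=> s0 /andP[ss' s'b] /andP[sg0 sg1] Ks s'0 [k0 hk0].
have sg01 : 0 <= sg < 1 by rewrite ltW.
have q4 : 0 < 4^-1 :> R by rewrite invr_gt0.
have [n0 hn0] := exprn_lt_eventually sg01 q4.
exists (maxn k0 n0) => k; rewrite geq_max => /andP[kk0 kn0] x Vx.
have n2 : (n0 <= 2 ^ k)%N by rewrite (leq_trans kn0) // ltnW // ltn_expl.
have {}hn0 := hn0 _ n2; have {}hk0 := hk0 _ kk0.
set n := (2 ^ k)%N in hn0 hk0 n2 *.
have t01 : 0 <= sg * s / s' <= 1.
  rewrite divr_ge0 ?mulr_ge0 ?(ltW s'0) ?(ltW sg0) //= ler_pdivrMr // mul1r.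
  by rewrite (le_trans _ ss') // ler_piMl // ltW.
have bb : cmod ((s'%:C)%C) <= beta by rewrite cmod_real // ltW.
set w := x - pw n ((s'%:C)%C) x.
have Vw : V w by rewrite /w -scaleNr addrC; apply: VP => //; exact: iterV.
have [y [y' [[Vy Vy'] hy hy' d]]] := dyadic_resolvent k bb t01 Vw.
have yx : y = x.
  apply/subr0_eq/(dyadic_injective (k := k) bb).
    by rewrite -scaleN1r addrC; exact: VP.
  by rewrite pwDx pwNx opprD addrACA -opprD hy subrr.
have sn m (u : R) z : 0 <= u -> rnorm (pw m ((u%:C)%C) z) = u ^+ m * rnorm (iter m T z).
  by move=> u0; rewrite rnormZ cmodX cmod_real.
rewrite -sn; last exact: ltW.
(* y' and x are the images of w under the inverses at sg * s and at s' *)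
have h1 : rnorm (y' - w) <= 4^-1 * rnorm y'.
  rewrite -{1}hy' opprB addrC subrK -rmorphM /= divfK ?gt_eqF //.
  rewrite sn ?mulr_ge0 ?(ltW sg0) // exprMn -mulrA.
  apply: ler_pM; rewrite ?exprn_ge0 ?mulr_ge0 ?rnorm_ge0 ?(ltW sg0) ?exprn_ge0 //.
    exact: ltW.
  exact: hk0.
rewrite yx in d.
have h2 : rnorm (x - y') <= 6^-1 * rnorm w.
  by apply: (le_trans d); apply: ler_wpM2r => //; exact: rnorm_ge0.
have h3 := rnormD (y' - w) w; rewrite subrK in h3.
have h4 := rnormD (x - y') (y' - w); rewrite addrA subrK in h4.
have h5 : rnorm (pw n ((s'%:C)%C) x) = rnorm (x - w) by rewrite /w opprB addrC subrK.
have h6 : rnorm w <= rnorm x + rnorm (x - w).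
  by rewrite -{1}(subrK x w) addrC -(rnormN (x - w)) opprB rnormD.
by rewrite h5; have := rnorm_ge0 w; lra.
Qed.

(** Starting from a small s0, each step multiplies s by a fixed factor th > 1,
    until s reaches beta > 1. *)
Lemma dyadic_decay : exists M r, [/\ (0 < M)%N, 0 < r < 1 &
  forall x, V x -> rnorm (iter M T x) <= r ^+ M * rnorm x].
Proof.
have b0 : 0 < beta by rewrite (lt_trans ltr01).
(* t0 < sg < 1 are chosen so that K * (1 - t0) <= 1 / 6: a ratio sg * s / s' of
   at least t0 is what the step lemma needs, which allows s' up to s * sg / t0 *)
pose t0 := 1 - (6 * (K + 1))^-1.
have K1 : 0 < K + 1 by rewrite ltr_pwDr.
have q0 : 0 < (6 * (K + 1))^-1 by rewrite invr_gt0 mulr_gt0.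
have q6 : K * (6 * (K + 1))^-1 <= 6^-1.
  by rewrite invfM mulrCA ler_piMr // ler_pdivrMr // mul1r lerDl.
have q1 : (6 * (K + 1))^-1 < 1.
  by rewrite invf_lt1 ?mulr_gt0 //; have := K0; lra.
pose sg := 1 - (6 * (K + 1))^-1 / 2.
have t00 : 0 < t0 by rewrite /t0; lra.
have [th [thE th1]] : exists th, th * t0 = sg /\ 1 < th.
  exists (sg / t0); rewrite divfK ?gt_eqF //; split=> //.
  by rewrite ltr_pdivlMr // mul1r /t0 /sg; lra.
pose s0 := Num.min beta (tau + 1)^-1.
have tau1 : 0 < tau + 1 by rewrite ltr_pwDr.
have s00 : 0 < s0 by rewrite /s0 lt_min b0 invr_gt0.
have base : bnd s0.
  exists 0%N => k _ x Vx; elim: (2 ^ k)%N => [|n IH]; first by rewrite mul1r.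
  apply: le_trans IH; rewrite exprSr -mulrA ler_wpM2l ?exprn_ge0 ?(ltW s00) //.
  have h := Tb (iter n T x); have h0 := rnorm_ge0 (iter n T x).
  apply: (@le_trans _ _ ((tau + 1)^-1 * (tau * rnorm (iter n T x)))).
    apply: ler_pM => //; rewrite ?rnorm_ge0 ?(ltW s00) //.
    by rewrite /s0 ge_min lexx orbT.
  by rewrite mulrA ler_piMl // mulrC ler_pdivrMr // mul1r lerDl.
have all i : bnd (Num.min beta (s0 * th ^+ i)).
  elim: i => [|i IH]; first by rewrite mulr1 /s0 minA minxx.
  set s := Num.min _ _ in IH; set s' := Num.min _ _.
  have spos : 0 < s by rewrite lt_min b0 mulr_gt0 // exprn_gt0 // (lt_trans ltr01).
  have s'le : s' <= s * th.
    rewrite /s' ge_min /s exprSr mulrA; case: (leP beta (s0 * th ^+ i)) => _.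
      by rewrite ler_peMr // ltW.
    by rewrite lexx orbT.
  have ss' : s <= s'.
    rewrite /s /s' le_min !ge_min lexx /= exprSr mulrA; apply/orP; right.
    by rewrite ler_peMr ?mulr_ge0 ?exprn_ge0 ?(ltW s00) // ltW // (lt_trans ltr01).
  have s'pos : 0 < s' := lt_le_trans spos ss'.
  apply: (dyadic_step (s := s) (sg := sg)) => //; first exact: ltW.
  - by rewrite ss' /=; rewrite /s' ge_min; apply/orP; left.
  - by rewrite /sg; lra.
  have : t0 <= sg * s / s'.
    rewrite ler_pdivlMr // (le_trans (ler_wpM2l (ltW t00) s'le)) //.
    by rewrite mulrCA [t0 * _]mulrC thE mulrC.
  move=> h; apply: le_trans q6; apply: ler_wpM2l => //.
  by move: h; rewrite /t0; lra.
have [i hi] := exprn_ge_eventually (beta / s0) th1.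
have := all i; rewrite min_l; last by rewrite mulrC -ler_pdivrMr.
case=> k0 /(_ k0 (leqnn _)) H; exists (2 ^ k0)%N, beta^-1; split.
- by rewrite expn_gt0.
- by rewrite invr_gt0 b0 invf_lt1.
by move=> x Vx; rewrite exprVn mulrC ler_pdivlMr ?exprn_gt0 // mulrC; exact: H.
Qed.
End Dyadic.

(** * Deadbeat feedback *)

Section Deadbeat.
Variables (F : fieldType) (V U : vectType F) (T : 'End(V)) (B : 'Hom(U, V)).

Let loop (K : 'Hom(V, U)) x := T x + B (K x).

(** Some feedback brings every state of W to 0 without leaving W. *)
Let vanishes (W : {vspace V}) := exists (K : 'Hom(V, U)) (k : nat),
  (forall x, x \in W -> loop K x \in W) /\
  (forall x, x \in W -> iter k (loop K) x = 0).

(** The states that some input moves into W in one step. *)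
Let next (W : {vspace V}) : {vspace V} := (T @^-1: (W + limg B))%VS.

Let vanishes_next W : vanishes W -> (W <= next W)%VS /\ vanishes (next W).
Proof.
case=> K [k [KW Kk]].
have sub : (W <= next W)%VS.
  apply/subvP=> x xW; rewrite -memv_preim.
  have -> : T x = loop K x - B (K x) by rewrite addrK.
  by apply: memv_add; [exact: KW | rewrite memvN memv_img ?memvf].
split=> //.
(* K' agrees with K on W; off W it cancels the component of T x in im B, so that
   T x + B (K' x) falls in W. *)
pose K'' : 'Hom(V, U) := (- ((B^-1 \o addv_pi2 W (limg B)) \o T))%VF.
pose K' : 'Hom(V, U) := ((K \o projv W) + (K'' \o (\1 - projv W)))%VF.
have K'E x : K' x = K (projv W x)
    - (B^-1)%VF (addv_pi2 W (limg B) (T (x - projv W x))).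
  by rewrite !(add_lfunE, comp_lfunE, opp_lfunE, id_lfunE).
have K'W x : x \in W -> loop K' x = loop K x.
  by move=> xW; rewrite /loop K'E projv_id // subrr !linear0 addr0.
have K'next x : x \in next W -> loop K' x \in W.
  move=> xN.
  have split1 : x = projv W x + (x - projv W x) by rewrite addrC subrK.
  have pW : projv W x \in W by exact: memv_proj.
  have loopD y z : loop K' (y + z) = loop K' y + loop K' z.
    by rewrite /loop !linearD /= addrACA.
  rewrite split1 loopD; apply: memvD; first by rewrite K'W // KW.
  set y := x - _; have yN : y \in next W by rewrite memvB // (subvP sub).
  have yp : projv W y = 0 by rewrite /y linearB /= (projv_id pW) subrr.
  have -> : loop K' y = T y - addv_pi2 W (limg B) (T y).
    rewrite /loop K'E yp linear0 add0r subr0 linearN /=.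
    by rewrite limg_lfunVK // memv_pi2.
  move: yN; rewrite -memv_preim => /addv_pi1_pi2 {1}<-.
  by rewrite addrK memv_pi1.
exists K', k.+1; split=> x xN.
  by apply: (subvP sub); apply: K'next.
rewrite iterSr; have xW := K'next _ xN.
suff H j z : z \in W -> iter j (loop K') z = iter j (loop K) z /\ iter j (loop K) z \in W.
  by rewrite (H k _ xW).1 Kk.
move=> zW; elim: j => [|j [IH1 IH2]] //=.
by rewrite IH1 K'W //; split=> //; apply: KW.
Qed.

(** The subspaces steered to 0 in k steps grow with k.  If they stop growing at
    W, comparing dimensions in W = T^-1(W + im B) shows that im B lies in W and
    that W is T-invariant, hence W is everything by controllability. *)
Lemma deadbeat_feedback :
  (forall W : {vspace V}, (limg B <= W)%VS -> (T @: W <= W)%VS -> W = fullv) ->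
  exists (K : 'Hom(V, U)) (k : nat), forall x, iter k (fun y => T y + B (K y)) x = 0.
Proof.
move=> ctrl.
have grow W : vanishes W -> W <> fullv -> (\dim W < \dim (next W))%N.
  move=> vW Wf; have [sub _] := vanishes_next vW.
  rewrite ltn_neqAle dimvS // andbT; apply/negP => /eqP deq; apply: Wf.
  have Weq : W = next W by apply/eqP; rewrite eqEdim sub deq leqnn.
  have BW : (limg B <= W)%VS.
    have : \dim (W + limg B)%VS = \dim W.
      apply/eqP; rewrite eqn_leq [X in _ && X]dimvS ?addvSl // andbT.
      have eT := limg_ker_dim T fullv; rewrite capfv in eT.
      have eN := limg_ker_dim T (next W).
      have lN : (lker T <= next W)%VS by rewrite -lpreim0 lpreimS // sub0v.
      rewrite (capv_idPr lN) in eN.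
      have imN : (T @: next W = (W + limg B) :&: limg T)%VS.
        by rewrite /next -lpreim_cap_limg lpreimK // capvSr.
      have := dimv_sum_cap (W + limg B) (limg T).
      have := dimvS (subvf (W + limg B + limg T)%VS).
      rewrite -imN; have := congr1 (fun U => \dim U) Weq.
      move: eT eN; lia.
    move=> dd; have /eqP -> : W == (W + limg B)%VS by rewrite eqEdim addvSl dd leqnn.
    exact: addvSr.
  apply: ctrl => //; apply/subvP => y /memv_imgP[x xW ->].
  by move: xW; rewrite {1}Weq -memv_preim (addv_idPl BW).
suff H d W : vanishes W -> (\dim (fullv : {vspace V}) - \dim W <= d)%N -> vanishes fullv.
  have v0 : vanishes 0%VS.
    exists 0, 0%N; split=> x; rewrite memv0 => /eqP -> //.
    by rewrite /loop !linear0 addr0 memv0.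
  have [K [k [_ Kk]]] := H _ _ v0 (leqnn _).
  by exists K, k => x; apply: Kk; exact: memvf.
elim: d W => [|d IH] W vW dW.
  suff <- : W = fullv by [].
  by apply/eqP; rewrite eqEdim subvf -subn_eq0 -leqn0.
case: (eqVneq W fullv) => [<- //|/eqP Wf].
apply: (IH (next W)); first exact: (vanishes_next vW).2.
have := grow W vW Wf; have := dimvS (subvf (next W)); move: dW; lia.
Qed.
End Deadbeat.

(** * Joint control of plant modes and exosystem modes; observers *)

Lemma char_poly_tr (F : fieldType) m (M : 'M[F]_m) : char_poly M^T = char_poly M.
Proof.
rewrite /char_poly -det_tr; congr (\det _).
by rewrite /char_poly_mx linearB /= tr_scalar_mx map_trmx trmxK.
Qed.

Section CombinedControllability.
Variables (F : fieldType) (m p n : nat).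
Variables (M : 'M[F]_m) (B : 'M[F]_(m, p)) (lam : 'I_n -> F) (H : 'I_n -> 'M[F]_p).

Local Notation V := ('cV[F]_m * {ffun 'I_n -> 'cV[F]_p})%type.

(** The plant modes and the exosystem modes side by side, in the coordinates
    where they are coupled only through the input. *)
Definition modal_step (s : V) : V := (M *m s.1, [ffun l => lam l *: s.2 l]).
Definition modal_input (u : 'cV[F]_p) : V := (B *m u, [ffun l => - (H l *m u)]).

Let modal_step_linear : linear modal_step.
Proof.
move=> a x y; rewrite /modal_step; congr (_, _).
  by rewrite /= mulmxDr -scalemxAr.
by apply/ffunP=> l; rewrite !ffunE scalerDr !scalerA mulrC.
Qed.
Let modal_input_linear : linear modal_input.
Proof.
move=> a x y; rewrite /modal_input; congr (_, _).
  by rewrite /= mulmxDr -scalemxAr.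
by apply/ffunP=> l; rewrite !ffunE mulmxDr -scalemxAr opprD scalerN.
Qed.
HB.instance Definition _ := GRing.isLinear.Build F V V _ modal_step modal_step_linear.
HB.instance Definition _ := GRing.isLinear.Build F 'cV[F]_p V _ modal_input modal_input_linear.

Hypothesis reach : forall x1 : 'cV[F]_m, exists (N : nat) (x : nat -> 'cV[F]_m)
    (u : nat -> 'cV[F]_p),
    [/\ x 0%N = 0, forall k, x k.+1 = M *m x k + B *m u k & x N = x1].
Hypothesis lam_inj : injective lam.
Hypothesis lamM : forall l (x : 'cV[F]_m), M *m x = lam l *: x -> x = 0.
Hypothesis H_unit : forall l, H l \in unitmx.

Let pe (f : {poly F}) (x : 'cV[F]_m) :=
  \sum_(i < size f) f`_i *: iter i (mulmx M) x.

Let pe_char_poly x : pe (char_poly M) x = 0.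
Proof.
rewrite /pe; case: m M x => [|m'] M' x; first by rewrite (flatmx0 (\sum_(i < _) _)).
have CH := Cayley_Hamilton M'.
have it i : iter i (mulmx M') x = M' ^+ i *m x.
  by elim: i => [|i /= ->]; rewrite ?mul1mx // exprS mulmxA.
transitivity (horner_mx M' (char_poly M') *m x); last by rewrite CH mul0mx.
rewrite /horner_mx /horner_morph /= horner_coef size_map_poly mulmx_suml.
by apply: eq_bigr => i _; rewrite coef_map /= it -[_%:M * _]/(_ *m _) mul_scalar_mx -scalemxAl.
Qed.

Let char_poly_lam l : (char_poly M).[lam l] != 0.
Proof.
apply/negP; rewrite -/(root _ _) -char_poly_tr -eigenvalue_root_char.
case/eigenvalueP=> v vM v0; case/eqP: v0; apply: trmx_inj; rewrite trmx0.
by apply: (@lamM l); rewrite -[M]trmxK -trmx_mul vM linearZ.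
Qed.

(** Controllability of the joint system: the characteristic polynomial of M
    annihilates the first component and is nonzero at each lam_l, and a Lagrange
    product then isolates one exosystem mode.  So an invariant subspace that
    contains the inputs contains each exosystem mode, and then all of the first
    component, which is reachable. *)
Lemma deadbeat_modal_feedback :
  exists (K : {linear V -> 'cV[F]_p}) (k : nat),
    forall s, iter k (fun s => modal_step s + modal_input (K s)) s = 0.
Proof.
have [|K [k Kk]] := @deadbeat_feedback F V 'cV[F]_p (linfun modal_step) (linfun modal_input).
  move=> W BW TW.
  have BfW u : modal_input u \in W.
    by apply: (subvP BW); apply/memv_imgP; exists u; rewrite ?memvf ?lfunE.
  have TfW s : s \in W -> modal_step s \in W.
    by move=> sW; apply: (subvP TW); apply/memv_imgP; exists s; rewrite ?lfunE.
  have iterT i s : iter i modal_step s = (iter i (mulmx M) s.1, [ffun l => lam l ^+ i *: s.2 l]).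
    elim: i => [|i IH]; last first.
      rewrite /= IH /modal_step /=; congr (_, _); apply/ffunP=> l.
      by rewrite !ffunE scalerA exprS.
    by case: s => a b /=; congr (_, _); apply/ffunP=> l; rewrite ffunE scale1r.
  have pW (f : {poly F}) x v : (x, v) \in W ->
      (pe f x, [ffun l => f.[lam l] *: v l]) \in W.
    move=> sW; have -> : (pe f x, [ffun l => f.[lam l] *: v l]) =
        \sum_(i < size f) f`_i *: iter i modal_step (x, v) :> V.
      rewrite [RHS]surjective_pairing; congr (_, _).
        by rewrite raddf_sum; apply: eq_bigr => i _; rewrite iterT.
      apply/ffunP=> l; rewrite ffunE raddf_sum sum_ffunE horner_coef scaler_suml.
      by apply: eq_bigr => i _; rewrite iterT /= !ffunE scalerA.
    apply: memv_suml => i _; apply: memvZ.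
    by elim: (i : nat) => //= j; apply: TfW.
  have single l (v : 'cV_p) : (0, [ffun j => if j == l then v else 0]) \in W.
    (* after the characteristic polynomial, only the modes remain; g kills all of
       them but the l-th *)
    pose g := \prod_(j | j != l) ('X - (lam j)%:P).
    pose c := g.[lam l] * (char_poly M).[lam l].
    have c0 : c != 0.
      rewrite mulf_neq0 // /g horner_prod prodf_seq_neq0; apply/allP => j _.
      apply/implyP => jl; rewrite hornerXsubC subr_eq0.
      by apply: contra jl => /eqP/lam_inj ->.
    have := pW g _ _ (pW (char_poly M) _ _ (BfW (- (invmx (H l) *m (c^-1 *: v))))).
    rewrite pe_char_poly.
    have -> : pe g 0 = 0.
      rewrite /pe big1 // => i _; rewrite (_ : iter i _ 0 = 0) ?scaler0 //.
      by elim: (i : nat) => //= j ->; rewrite mulmx0.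
    congr ((_, _) \in W); apply/ffunP=> j; rewrite !ffunE.
    case: eqP => [->|/eqP jl].
      rewrite mulmxN opprK mulmxA mulmxV // mul1mx !scalerA -/c divff //.
      by rewrite scale1r.
    by rewrite /g horner_prod (bigD1 j) //= hornerXsubC subrr mul0r scale0r.
  have zv v : (0, v) \in W.
    have -> : (0, v) = \sum_l (0, [ffun j => if j == l then v l else 0]) :> V.
      rewrite [RHS]surjective_pairing; congr (_, _).
        by rewrite raddf_sum /= big1.
      apply/ffunP=> l; rewrite raddf_sum sum_ffunE (bigD1 l) //= ffunE eqxx.
      by rewrite big1 ?addr0 // => j jl; rewrite ffunE eq_sym (negbTE jl).
    by apply: memv_suml => i _; exact: single.
  apply/eqP; rewrite eqEsubv subvf /=; apply/subvP => -[x v] _.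
  have [N [xs [u [x0 xS <-]]]] := reach x.
  suff xW k : (xs k, 0) \in W.
    have -> : (xs N, v) = (xs N, 0) + (0, v) :> V by congr (_, _); rewrite /= ?addr0 ?add0r.
    exact: memvD.
  elim: k => [|k IH]; first by rewrite x0 mem0v.
  have -> : (xs k.+1, 0) = modal_step (xs k, 0) + modal_input (u k) - (0, (modal_input (u k)).2) :> V.
    rewrite [RHS]surjective_pairing /= xS subr0; congr (_, _).
    by apply/ffunP=> l; rewrite !ffunE scaler0 add0r subrr.
  by rewrite memvB // memvD // TfW.
exists K, k => s; rewrite -[RHS](Kk s); elim: k {Kk} => //= k ->.
by rewrite !lfunE.
Qed.
End CombinedControllability.

Section Observer.
Variables (F : fieldType) (m p : nat) (M : 'M[F]_m) (C : 'M[F]_(p, m)).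

Lemma annihilator (W : {vspace 'cV[F]_m}) : W <> fullv ->
  exists2 x : 'cV[F]_m, x != 0 & forall w, w \in W -> x^T *m w = 0.
Proof.
move=> Wf; pose b := vbasis W.
pose A : 'M[F]_(m, \dim W) := \matrix_(i, j) b`_j i 0.
have rk : kermx A != 0.
  rewrite -mxrank_eq0 mxrank_ker subn_eq0 -ltnNge.
  apply: leq_ltn_trans (rank_leq_col A) _.
  rewrite ltnNge; apply/negP => h; apply: Wf; apply/eqP.
  by rewrite eqEdim subvf dimvf /dim /= muln1 h.
have [i ri] : exists i, row i (kermx A) != 0.
  by apply/existsP; rewrite -negb_forall; apply: contra rk => /forallP h;
     apply/eqP/row_matrixP => i; rewrite row0; apply/eqP.
exists (row i (kermx A))^T; first by rewrite trmx_eq0.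
rewrite trmxK => w wW; rewrite (coord_vbasis wW) mulmx_sumr big1 // => j _.
rewrite -scalemxAr (_ : _ *m _ = 0) ?scaler0 //.
apply/matrixP => a c; rewrite !ord1 [RHS]mxE.
have := congr1 (fun Z : 'M[F]_(m, \dim W) => Z i j) (mulmx_ker A).
rewrite [X in _ = X -> _]mxE => <-; rewrite !mxE.
by apply: eq_bigr => k _; rewrite !mxE.
Qed.

(** Duality with [deadbeat_feedback], through transposition. *)
Lemma deadbeat_observer :
  (forall x : 'cV[F]_m, (forall k, C *m iter k (mulmx M) x = 0) -> x = 0) ->
  exists (L : 'M[F]_(m, p)) (k : nat),
    forall x : 'cV[F]_m, iter k (mulmx (M + L *m C)) x = 0.
Proof.
move=> obs.
pose T : 'End('cV[F]_m) := linfun (mulmx M^T).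
pose B : 'Hom('cV[F]_p, 'cV[F]_m) := linfun (mulmx C^T).
have [|K [k Kk]] := @deadbeat_feedback F _ _ T B.
  move=> W BW TW; apply: contrapT => Wf; have [x x0 xW] := annihilator Wf.
  case/eqP: x0; apply: obs => k; apply/matrixP => i j; rewrite ord1 mxE.
  have wW : iter k (mulmx M^T) (C^T *m delta_mx i 0) \in W.
    elim: k => [|k IH] /=.
      apply: (subvP BW); apply/memv_imgP; exists (delta_mx i 0); rewrite ?memvf //.
      by rewrite lfunE.
    by apply: (subvP TW); apply/memv_imgP; eexists; [exact: IH | rewrite lfunE].
  have itT (q : 'cV[F]_m) : x^T *m iter k (mulmx M^T) q = (iter k (mulmx M) x)^T *m q.
    elim: k {wW} q => //= k IH q.
    by rewrite -iterS iterSr IH trmx_mul -mulmxA.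
  have := xW _ wW; rewrite itT => /(congr1 trmx); rewrite trmx0 !trmx_mul !trmxK.
  rewrite -mulmxA trmx_delta -rowE => /(congr1 (fun Z : 'M[F]_1 => Z 0 0)).
  by rewrite !mxE.
pose L : 'M[F]_(m, p) := (\matrix_(i, j) K (delta_mx j 0) i 0)^T.
have KE x : K x = L^T *m x.
  rewrite trmxK {1}[x]matrix_sum_delta; apply/matrixP => i j; rewrite ord1.
  rewrite linear_sum /= summxE !mxE; apply: eq_bigr => a _.
  by rewrite big_ord1 linearZ /= !mxE mulrC.
have KT j x : iter j (fun y => T y + B (K y)) x = iter j (mulmx (M + L *m C)^T) x.
  elim: j => //= j ->; rewrite !lfunE /= KE linearD /= mulmxDl trmx_mul.
  by rewrite mulmxA.
exists L, k => x; apply/matrixP => i j; rewrite ord1 [RHS]mxE.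
have itT (q : 'cV[F]_m) : (iter k (mulmx (M + L *m C)) x)^T *m q =
    x^T *m iter k (mulmx (M + L *m C)^T) q.
  elim: (k) q => //= k' IH q.
  by rewrite trmx_mul -mulmxA IH -[RHS]/(_ *m iter k'.+1 _ q) iterSr.
have := itT (delta_mx i 0); rewrite -KT Kk mulmx0.
by rewrite -colE => /(congr1 (fun Z : 'M[F]_1 => Z 0 0)); rewrite !mxE.
Qed.
End Observer.

(** * Euclidean spaces as Hilbert spaces *)

Section EuclideanSpace.
Variables (R : realType) (I : finType).

(** The functions from a finite type to the complex numbers with the Euclidean
    norm; matrices would carry the sup norm, which comes from no inner
    product. *)
Definition ell2 := {ffun I -> (R[i])^o}.
HB.instance Definition _ := GRing.Lmodule.on ell2.
HB.instance Definition _ := Vector.copy ell2 {ffun I -> (R[i])^o}.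

Definition ell2_inner (x y : ell2) : R[i] := \sum_i x i * Num.conj (y i).

Let inner_bilinear : bilinear_for
  (GRing.Scale.Law.clone _ _ *%R _) (GRing.Scale.Law.clone _ _ (Num.conj \; *%R) _)
  ell2_inner.
Proof.
split=> z a x y /=; rewrite /ell2_inner /=.
  rewrite [X in _ = X + _]mulr_sumr -big_split /=.
  by apply: eq_bigr => i _; rewrite !ffunE mulrDl mulrA.
rewrite [X in _ = X + _]mulr_sumr -big_split /=.
by apply: eq_bigr => i _; rewrite !ffunE rmorphD rmorphM /= mulrDr mulrCA.
Qed.
HB.instance Definition _ :=
  bilinear_isBilinear.Build R[i] ell2 ell2 R[i] _ _ ell2_inner inner_bilinear.

Let inner_hermitian x y : ell2_inner x y = (-1) ^+ false * Num.conj (ell2_inner y x).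
Proof.
rewrite mul1r /ell2_inner rmorph_sum /=; apply: eq_bigr => i _.
by rewrite rmorphM /= conjCK mulrC.
Qed.
HB.instance Definition _ :=
  isHermitianSesquilinear.Build R[i] ell2 false Num.conj ell2_inner inner_hermitian.

Let inner_pos x : x != 0 -> 0 < ell2_inner x x.
Proof.
move=> x0; have [i xi] : exists i, x i != 0.
  apply/existsP; rewrite -negb_forall; apply: contra x0 => /forallP h.
  by apply/eqP/ffunP => i; rewrite ffunE; apply/eqP.
rewrite /ell2_inner (bigD1 i) //= ltr_pwDl //.
  by rewrite -normCK exprn_gt0 // normr_gt0.
by apply: sumr_ge0 => j _; rewrite -normCK exprn_ge0.
Qed.
HB.instance Definition _ :=
  isDotProduct.Build R[i] ell2 ell2_inner inner_pos.

Let dot : {dot ell2 for Num.conj} := ell2_inner.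

Definition ell2_norm (x : ell2) : R[i] := sqrtC (ell2_inner x x).

Let norm_triangle x y : ell2_norm (x + y) <= ell2_norm x + ell2_norm y.
Proof. exact: (triangle_lerif dot x y). Qed.
Let normZ a x : ell2_norm (a *: x) = `|a| * ell2_norm x.
Proof.
rewrite /ell2_norm (dnormZ dot) rootCMl ?exprn_ge0 //.
by rewrite sqrCK.
Qed.
Let norm_eq0 x : ell2_norm x = 0 -> x = 0.
Proof. by move/eqP; rewrite (sqrt_dnorm_eq0 dot) => /eqP. Qed.

HB.instance Definition _ :=
  Lmodule_isNormed.Build R[i] ell2 norm_triangle normZ norm_eq0.

Lemma ell2_cmod_le (x : ell2) i : cmod (x i) <= rnorm x.
Proof.
rewrite -lecR -cmodE -rnormE -(sqrCK (normr_ge0 (x i))) ler_sqrtC ?nnegrE ?exprn_ge0 //.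
  by rewrite /ell2_inner (bigD1 i) //= -normCK lerDl sumr_ge0 // => j _;
     rewrite -normCK exprn_ge0.
by rewrite (dnorm_ge0 dot).
Qed.

Lemma ell2_rnorm_le (x : ell2) : rnorm x <= \sum_i cmod (x i).
Proof.
rewrite -lecR -rnormE -(@ler_pXn2r _ 2) ?nnegrE //; last first.
  by rewrite ler0c sumr_ge0 // => i _; rewrite cmod_ge0.
rewrite sqrtCK [X in X <= _](_ : _ = ((\sum_i cmod (x i) ^+ 2)%:C)%C); last first.
  by rewrite rmorph_sum; apply: eq_bigr => i _; rewrite -normCK cmodE rmorphXn.
rewrite -rmorphXn /= lecR expr2 mulr_suml; apply: ler_sum => i _.
rewrite expr2 ler_wpM2l ?cmod_ge0 // (bigD1 i) //= lerDl.
by apply: sumr_ge0 => j _; rewrite cmod_ge0.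
Qed.

Let ell2_complete (F : set_system ell2) : ProperFilter F -> cauchy F -> cvg F.
Proof.
move=> FF /cauchy_ballP Fc.
have Fc' (e : R) : 0 < e -> \forall z & y \near F, rnorm (z - y : ell2) < e.
  move=> e0; have := Fc ((e%:C)%C); rewrite ltcR => /(_ e0).
  apply: filterS => -[z y]; rewrite /= -ball_normE /= rnormE.
  by rewrite ltcR.
have cv (f : R[i] -> R) : (forall z, `|f z| <= cmod z) ->
    (forall z y, f (z - y) = f z - f y) ->
    forall i, cvg ((fun x : ell2 => f (x i)) @ F).
  move=> fle fB i; apply: R_complete; apply/cauchy_ballP => e e0.
  rewrite near_map2.
  have := Fc' e e0; apply: filterS => -[z y] /= h.
  rewrite /ball /= -fB; apply: le_lt_trans (fle _) _.
  apply: le_lt_trans h; have := ell2_cmod_le (z - y) i.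
  by rewrite !ffunE.
have cvRe := cv (@complex.Re R) (@normRe_le R) _.
have cvIm := cv (@complex.Im R) (@normIm_le R) _.
have {}cvRe := cvRe (fun z y => ltac:(by case: z; case: y)).
have {}cvIm := cvIm (fun z y => ltac:(by case: z; case: y)).
pose a i := lim ((fun x : ell2 => complex.Re (x i)) @ F).
pose b i := lim ((fun x : ell2 => complex.Im (x i)) @ F).
pose L : ell2 := [ffun i => (a i +i* b i)%C].
apply/cvg_ex; exists L; apply/cvgrPdist_lt => e e0.
have eE : e = ((cmod e)%:C)%C by rewrite -cmodE gtr0_norm.
have ce : 0 < cmod e by rewrite -ltcR -eE.
pose N := (#|I|.+1)%:R : R.
have N0 : 0 < N by rewrite ltr0n.
pose d := cmod e / (2 * N).
have d0 : 0 < d by rewrite divr_gt0 ?mulr_gt0.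
have HRe : \forall x \near F, forall i, `|a i - complex.Re ((x : ell2) i)| < d.
  apply: filter_forall => i; move: (cvRe i) => /cvgrPdist_lt/(_ d d0).
  exact.
have HIm : \forall x \near F, forall i, `|b i - complex.Im ((x : ell2) i)| < d.
  apply: filter_forall => i; move: (cvIm i) => /cvgrPdist_lt/(_ d d0).
  exact.
apply: filterS (filterI HRe HIm) => x [xRe xIm]; rewrite rnormE eE ltcR.
apply: le_lt_trans (ell2_rnorm_le _) _.
apply: (@le_lt_trans _ _ (\sum_(i : I) (2 * d))).
  apply: ler_sum => i _; rewrite !ffunE.
  case E : (x i) => [u v].
  have -> : (a i +i* b i - (u +i* v) = (a i - u) +i* (b i - v))%C by [].
  apply: le_trans (cmod_leD _ _) _.
  have h1 : `|a i - complex.Re (x i)| < d by exact: xRe.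
  have h2 : `|b i - complex.Im (x i)| < d by exact: xIm.
  by rewrite E /= in h1 h2; lra.
have -> : 2 * d = cmod e / N by rewrite /d; field; rewrite gt_eqF.
rewrite sumr_const -mulr_natr.
by rewrite mulrAC ltr_pdivrMr // ltr_pM2l // ltr_nat.
Qed.

HB.instance Definition _ := Uniform_isComplete.Build ell2 ell2_complete.

Let ell2_sqr_norm (x : ell2) : `|x| ^+ 2 = dot x x.
Proof. by rewrite sqrtCK. Qed.
HB.instance Definition _ :=
  @CompleteNormedModule_isHilbert.Build R ell2 dot ell2_sqr_norm.

Definition ell2_unit i : ell2 := [ffun j => (j == i)%:R].

Lemma ell2_unitE c i j : (c *: ell2_unit i) j = if j == i then c else 0.
Proof. by rewrite !ffunE; case: eqP => _; [exact: mulr1 | exact: mulr0]. Qed.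

Lemma ell2_sum_unit (x : ell2) : x = \sum_i x i *: ell2_unit i.
Proof.
apply/ffunP=> j; rewrite sum_ffunE (bigD1 j) //= ell2_unitE eqxx.
by rewrite big1 ?addr0 // => i ij; rewrite ell2_unitE eq_sym (negbTE ij).
Qed.

Lemma ell2_finite_dim : finite_dim [set: ell2].
Proof.
exists #|I|, (fun k => ell2_unit (enum_val k)); split.
  move=> c h k; have := congr1 (fun x : ell2 => x (enum_val k)) h.
  rewrite ffunE sum_ffunE (bigD1 k) //= ell2_unitE eqxx big1 ?addr0 // => j jk.
  by rewrite ell2_unitE (inj_eq enum_val_inj) eq_sym (negbTE jk).
apply/seteqP; split=> x // _; exists (fun k => x (enum_val k)).
rewrite {1}[x]ell2_sum_unit (reindex (@enum_val I predT)) //=.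
by exists (@enum_rank I) => i _; rewrite ?enum_valK ?enum_rankK.
Qed.

Lemma ell2_linear_continuous (Y : normedModType R[i]) (f : {linear ell2 -> Y}) :
  continuous f.
Proof.
apply: (@linear_bound_continuous _ _ _ f (\sum_i rnorm (f (ell2_unit i)))) => x.
rewrite {1}[x]ell2_sum_unit linear_sum mulr_suml.
apply: le_trans (sn_sum (seminorm_rnorm _) _ _ _) _.
apply: ler_sum => i _; rewrite linearZ rnormZ mulrC ler_wpM2l ?rnorm_ge0 //.
exact: ell2_cmod_le.
Qed.

End EuclideanSpace.

(** * Bounds between seminorms; power stability *)

Section SnBounded.
Variables (R : realType).

(** Nonnegativity of the constant is what makes bounds compose. *)
Definition sn_bounded (V W : lmodType R[i]) (q : V -> R) (r : W -> R) (f : V -> W) :=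
  exists M : R, 0 <= M /\ forall x, r (f x) <= M * q x.

Lemma sn_bounded_comp (V W Z : lmodType R[i]) (q : V -> R) (r : W -> R) (s : Z -> R) f g :
  sn_bounded q r f -> sn_bounded r s g -> sn_bounded q s (g \o f).
Proof.
case=> M [M0 Mf] [N [N0 Ng]]; exists (N * M); split; first exact: mulr_ge0.
by move=> x; rewrite -mulrA (le_trans (Ng _)) // ler_wpM2l.
Qed.

Lemma sn_bounded_add (V W : lmodType R[i]) (q : V -> R) (r : W -> R) f g :
  seminorm r -> sn_bounded q r f -> sn_bounded q r g ->
  sn_bounded q r (fun x => f x + g x).
Proof.
move=> sr [M [M0 Mf]] [N [N0 Ng]]; exists (M + N); split; first exact: addr_ge0.
by move=> x; rewrite mulrDl (le_trans (sn_add sr _ _)) // lerD.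
Qed.

Lemma sn_bounded_opp (V W : lmodType R[i]) (q : V -> R) (r : W -> R) f :
  seminorm r -> sn_bounded q r f -> sn_bounded q r (fun x => - f x).
Proof.
by move=> sr [M [M0 Mf]]; exists M; split=> // x; rewrite (snN sr).
Qed.

Lemma sn_bounded_sum (V W : lmodType R[i]) (q : V -> R) (r : W -> R)
    (I : finType) (f : I -> V -> W) : seminorm r ->
  (forall i, sn_bounded q r (f i)) -> sn_bounded q r (fun x => \sum_i f i x).
Proof.
move=> sr /choice [M HM]; exists (\sum_i M i); split.
  by apply: sumr_ge0 => i _; case: (HM i).
move=> x; rewrite mulr_suml (le_trans (sn_sum sr _ _ _)) //.
by apply: ler_sum => i _; case: (HM i).
Qed.

Lemma sn_bounded_bop (X Y : normedModType R[i]) (f : bounded_op X Y) :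
  sn_bounded (@rnorm R X) (@rnorm R Y) f.
Proof. by have [M [M0 Mf]] := bop_bound f; exists M; split=> //; exact: ltW. Qed.

End SnBounded.

Lemma mx_norm_ge_entry (K : numFieldType) (m n : nat) (v : 'M[K]_(m, n)) i j :
  `|v i j| <= `|v|.
Proof.
apply/ler_addgt0Pr => e e0.
have : ball (0 : 'M[K]_(m, n)) (`|v| + e) v.
  by rewrite -ball_normE /= sub0r normrN ltrDl.
case=> _ /(_ i j); rewrite mxE -ball_normE /= sub0r normrN.
exact: ltW.
Qed.

Section ColumnNorm.
Variables (R : realType) (p : nat).
Implicit Types v : 'cV[R[i]]_p.

(** A norm on C^p for intermediate estimates, equivalent to the Euclidean norm
    and additive over coordinates. *)
Definition cnorm v : R := \sum_i cmod (v i 0).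

Lemma seminorm_cnorm : seminorm cnorm.
Proof.
split=> [x|x y|a x]; first by apply: sumr_ge0 => i _; exact: cmod_ge0.
  by rewrite /cnorm -big_split; apply: ler_sum => i _; rewrite mxE cmodD.
by rewrite /cnorm mulr_sumr; apply: eq_bigr => i _; rewrite mxE cmodM.
Qed.

Lemma cmod_le_cnorm v i : cmod (v i 0) <= cnorm v.
Proof.
by rewrite /cnorm (bigD1 i) //= lerDl sumr_ge0 // => j _; exact: cmod_ge0.
Qed.

Lemma cmod_le_rnorm v i : cmod (v i 0) <= rnorm v.
Proof.
by rewrite -lecR -cmodE -rnormE mx_norm_ge_entry.
Qed.

Lemma cnorm_bounded_rnorm : sn_bounded (@rnorm R 'cV[R[i]]_p) cnorm id.
Proof.
exists p%:R; split=> // v.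
rewrite mulr_natl -[X in _ *+ X]card_ord -sumr_const.
by apply: ler_sum => i _; exact: cmod_le_rnorm.
Qed.

Lemma euclid_norm_le v : euclid_norm v <= cnorm v.
Proof.
rewrite -(@ler_pXn2r _ 2) ?nnegrE ?sqrtr_ge0 ?(sn_ge0 seminorm_cnorm) //.
rewrite sqr_sqrtr; last by apply: sumr_ge0 => i _; rewrite exprn_ge0 ?cmod_ge0.
rewrite expr2 /cnorm mulr_suml; apply: ler_sum => i _.
by rewrite expr2 ler_wpM2l ?cmod_ge0 ?cmod_le_cnorm.
Qed.

Lemma cmod_le_euclid v i : cmod (v i 0) <= euclid_norm v.
Proof.
rewrite -(@ler_pXn2r _ 2) ?nnegrE ?sqrtr_ge0 ?cmod_ge0 //.
rewrite sqr_sqrtr; last by apply: sumr_ge0 => j _; rewrite exprn_ge0 ?cmod_ge0.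
rewrite (bigD1 i) //= lerDl.
by apply: sumr_ge0 => j _; rewrite exprn_ge0 ?cmod_ge0.
Qed.

Lemma column_sum_delta v : v = \sum_i v i 0 *: delta_mx i 0.
Proof.
rewrite {1}[v]matrix_sum_delta; apply: eq_bigr => i _.
by rewrite big_ord1.
Qed.

Lemma sn_bounded_column (W : lmodType R[i]) (r : W -> R)
    (f : {linear 'cV[R[i]]_p -> W}) : seminorm r -> sn_bounded cnorm r f.
Proof.
move=> sr; exists (\sum_i r (f (delta_mx i 0))); split.
  by apply: sumr_ge0 => i _; exact: (sn_ge0 sr).
move=> v; rewrite {1}(column_sum_delta v) linear_sum mulr_suml.
apply: le_trans (sn_sum sr _ _ _) _.
apply: ler_sum => i _; rewrite linearZ (sn_scale sr) mulrC.
by rewrite ler_wpM2l ?(sn_ge0 sr) // cmod_le_cnorm.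
Qed.

Lemma sn_bounded_bop_col (X : normedModType R[i]) (f : bounded_op X 'cV[R[i]]_p) :
  sn_bounded (@rnorm R X) cnorm f.
Proof. exact: sn_bounded_comp (sn_bounded_bop f) cnorm_bounded_rnorm. Qed.

Lemma linear_column_continuous (Y : normedModType R[i])
    (f : {linear ('cV[R[i]]_p : normedModType R[i]) -> Y}) : continuous f.
Proof.
have [M [M0 HM]] := sn_bounded_column f (seminorm_rnorm Y).
have [N [N0 HN]] := cnorm_bounded_rnorm.
apply: (@linear_bound_continuous _ _ _ f (M * N)) => x.
by rewrite -mulrA (le_trans (HM _)) // ler_wpM2l.
Qed.

End ColumnNorm.

Section PairNorm.
Variables (R : realType) (X Y : normedModType R[i]).
Implicit Types z : X * Y.

(** Equivalent to [pair_norm], and additive, so that the components of a pair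
    can be estimated separately. *)
Definition sum_norm z : R := rnorm z.1 + rnorm z.2.

Lemma seminorm_sum_norm : seminorm sum_norm.
Proof.
split=> [x|x y|a x]; first by rewrite addr_ge0 ?rnorm_ge0.
  by rewrite /sum_norm addrACA lerD ?rnormD.
by rewrite /sum_norm /= !rnormZ mulrDr.
Qed.

Lemma sum_norm_eq0 z : sum_norm z = 0 -> z = 0.
Proof.
move/eqP; rewrite paddr_eq0 ?rnorm_ge0 // => /andP[/eqP h1 /eqP h2].
by rewrite [z]surjective_pairing (rnorm_eq0 h1) (rnorm_eq0 h2).
Qed.

Lemma pair_norm_ge0 z : 0 <= pair_norm z. Proof. exact: sqrtr_ge0. Qed.

Lemma pair_norm_sqr z : pair_norm z ^+ 2 = rnorm z.1 ^+ 2 + rnorm z.2 ^+ 2.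
Proof. by rewrite sqr_sqrtr // addr_ge0 ?sqr_ge0. Qed.

Lemma pair_norm_le_sum z : pair_norm z <= sum_norm z.
Proof.
rewrite -(@ler_pXn2r _ 2) ?nnegrE ?pair_norm_ge0 ?(sn_ge0 seminorm_sum_norm) //.
rewrite pair_norm_sqr /sum_norm sqrrD.
by have := mulr_ge0 (rnorm_ge0 z.1) (rnorm_ge0 z.2); lra.
Qed.

Lemma sum_norm_le_pair z : sum_norm z <= 2 * pair_norm z.
Proof.
have h (a b : R) : 0 <= a -> 0 <= b -> a <= Num.sqrt (a ^+ 2 + b ^+ 2).
  move=> a0 b0; rewrite -(@ler_pXn2r _ 2) ?nnegrE ?sqrtr_ge0 //.
  by rewrite sqr_sqrtr ?addr_ge0 ?sqr_ge0 // lerDl sqr_ge0.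
have h1 := h _ _ (rnorm_ge0 z.1) (rnorm_ge0 z.2).
have h2 := h _ _ (rnorm_ge0 z.2) (rnorm_ge0 z.1); rewrite addrC in h2.
by rewrite /sum_norm /pair_norm; lra.
Qed.

Lemma pair_normZ a z : pair_norm (a *: z) = cmod a * pair_norm z.
Proof.
rewrite /pair_norm /= !rnormZ !exprMn -mulrDr sqrtrM ?sqr_ge0 //.
by rewrite sqrtr_sqr ger0_norm ?cmod_ge0.
Qed.

Lemma pair_norm_eq0 z : pair_norm z = 0 -> z = 0.
Proof.
move=> h; apply: sum_norm_eq0; apply/eqP; rewrite eq_le.
by rewrite (sn_ge0 seminorm_sum_norm) andbT (le_trans (sum_norm_le_pair z)) // h mulr0.
Qed.

(** The operator norm of the definition is a supremum over the unit ball; for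
    bounded T it gives the pointwise estimate by scaling, and conversely. *)
Lemma power_stableP (T : {linear (X * Y)%type -> (X * Y)%type}) :
  sn_bounded sum_norm sum_norm T ->
  power_stable (@pair_norm R X Y) T <->
  exists Gamma rho : R, [/\ 0 <= Gamma, 0 < rho < 1 &
    forall k z, sum_norm (iter k T z) <= Gamma * rho ^+ k * sum_norm z].
Proof.
case=> M [M0 HM]; split.
  case=> Gam [rho [G1 rho01 HG]]; exists (2 * Gam), rho.
  have G0 : 0 <= Gam by rewrite (le_trans ler01).
  split=> [||k z]; rewrite ?mulr_ge0 //.
  have op : pair_norm (iter k T z) <= Gam * rho ^+ k * pair_norm z.
    have [z0|z0] := eqVneq (pair_norm z) 0.
      rewrite (pair_norm_eq0 z0) iter_linear0.
      by rewrite -[X in pair_norm X](scale0r 0) pair_normZ cmod0 mul0r mulr0.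
    have zp : 0 < pair_norm z by rewrite lt_def z0 pair_norm_ge0.
    rewrite -ler_pdivrMr //; apply: le_trans (HG k).
    set y := ((pair_norm z)^-1%:C)%C *: z.
    have -> : pair_norm (iter k T z) / pair_norm z = pair_norm (iter k T y).
      by rewrite iter_linearZ pair_normZ cmod_real ?invr_ge0 ?pair_norm_ge0 // mulrC.
    apply: sup_upper_bound; last first.
      exists y => //=.
      by rewrite pair_normZ cmod_real ?invr_ge0 ?pair_norm_ge0 // mulVf.
    split; first by exists (pair_norm (iter k T y)), y => //=;
      rewrite pair_normZ cmod_real ?invr_ge0 ?pair_norm_ge0 // mulVf.
    exists (M ^+ k * 2) => _ [x /= x1 <-].
    apply: le_trans (pair_norm_le_sum _) _.
    apply: (@le_trans _ _ (M ^+ k * sum_norm x)).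
      elim: (k) => [|j IH]; first by rewrite mul1r.
      by rewrite exprS -mulrA (le_trans (HM _)) // ler_wpM2l.
    rewrite ler_wpM2l ?exprn_ge0 // (le_trans (sum_norm_le_pair _)) //.
    by rewrite -[leRHS]mulr1 ler_wpM2l.
  apply: le_trans (sum_norm_le_pair _) _; rewrite -!mulrA ler_wpM2l //.
  rewrite mulrA (le_trans op) // ler_wpM2l ?pair_norm_le_sum // mulr_ge0 //.
  by rewrite exprn_ge0 // ltW //; case/andP: rho01.
case=> Gam [rho [G0 rho01 HG]]; exists (Num.max 1 (2 * Gam)), rho.
split=> // [|k]; first by rewrite le_max lexx.
have r0 : 0 <= rho ^+ k by rewrite exprn_ge0 // ltW //; case/andP: rho01.
apply: ge_sup.
  exists (pair_norm (iter k T 0)), 0 => //=.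
  by rewrite -[X in pair_norm X](scale0r 0) pair_normZ cmod0 mul0r.
move=> _ [x /= x1 <-]; apply: le_trans (pair_norm_le_sum _) _.
apply: le_trans (HG k x) _; rewrite mulrAC ler_wpM2r //.
apply: (@le_trans _ _ (2 * Gam)); last by rewrite le_max lexx orbT.
rewrite mulrC ler_wpM2r // (le_trans (sum_norm_le_pair _)) //.
by rewrite -[leRHS]mulr1 ler_wpM2l.
Qed.

End PairNorm.

Lemma geometric_cvg (R : realType) (X : completeNormedModType R[i]) (u : nat -> X)
    (c rho : R) : 0 < rho < 1 -> 0 <= c ->
  (forall k, rnorm (u k.+1 - u k) <= c * rho ^+ k) ->
  exists l, forall e, 0 < e -> exists N, forall k, (N <= k)%N -> rnorm (u k - l) < e.
Proof.
move=> /andP[r0 r1] c0 hu.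
have tail N j : rnorm (u (N + j)%N - u N) <= c * rho ^+ N * (1 - rho ^+ j) / (1 - rho).
  elim: j => [|j IH]; first by rewrite addn0 addrN rnorm0 expr0 subrr mulr0 mul0r.
  rewrite addnS; have := rnormD (u (N + j).+1 - u (N + j)%N) (u (N + j)%N - u N).
  rewrite addrA subrK => /le_trans; apply.
  have := hu (N + j)%N => h; apply: le_trans (lerD h IH) _.
  rewrite le_eqVlt; apply/orP; left; apply/eqP; rewrite exprD exprSr; field.
  by rewrite subr_eq0 gt_eqF.
have tail' N k : (N <= k)%N -> rnorm (u k - u N) <= c / (1 - rho) * rho ^+ N.
  move=> Nk; rewrite -(subnKC Nk) (le_trans (tail _ _)) //.
  rewrite [leRHS]mulrAC ler_wpM2r ?invr_ge0 ?subr_ge0 ?(ltW r1) //.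
  rewrite ler_piMr ?gerBl ?exprn_ge0 ?(ltW r0) //.
  by rewrite mulr_ge0 // exprn_ge0 // ltW.
have small (e : R) : 0 < e -> exists N, c / (1 - rho) * rho ^+ N < e.
  move=> e0; pose d := c / (1 - rho) + 1.
  have d0 : 0 < d by rewrite ltr_pwDr // divr_ge0 // subr_ge0 ltW.
  have [||N hN] := @exprn_lt_eventually R rho (e / d); rewrite ?divr_gt0 ?r1 ?(ltW r0) //.
  exists N; have := hN N (leqnn _); rewrite ltr_pdivlMr // mulrC => /(le_lt_trans _); apply.
  by rewrite ler_wpM2r ?exprn_ge0 ?(ltW r0) // lerDl.
have cu : cauchy (u @ \oo).
  apply/cauchy_exP => e e0.
  have eE : e = ((cmod e)%:C)%C by rewrite -cmodE gtr0_norm.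
  have ce : 0 < cmod e by rewrite -ltcR -eE.
  have [N hN] := small _ ce; exists (u N); exists N => // k /= Nk.
  rewrite /= -ball_normE /= eE rnormE ltcR -rnormN opprB.
  exact: le_lt_trans (tail' _ _ Nk) hN.
have ucvg : cvg (u @ \oo) by exact: cauchy_cvg cu.
have [l /cvgrPdist_lt ul] := (cvg_ex _).1 ucvg.
exists l => e e0; have /ul [N _ hN] : 0 < (e%:C)%C by rewrite ltcR.
by exists N => k /hN /=; rewrite rnormE ltcR -rnormN opprB.
Qed.

(** * The internal model principle *)

Lemma linear_fun_sum (K : pzRingType) (V W : lmodType K) (f : V -> W)
    (I : finType) (c : I -> K) (x : I -> V) :
  (forall a x y, f (a *: x + y) = a *: f x + f y) ->
  f (\sum_i c i *: x i) = \sum_i c i *: f (x i).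
Proof.
move=> fP; have f0 : f 0 = 0.
  have := fP 1 0 0; rewrite !scale1r addr0 => /(congr1 (fun t => t - f 0)).
  by rewrite addrK subrr => ->.
by elim/big_rec2: _ => // i y z _ <-; rewrite fP.
Qed.

Section SteadyState.
Variables (R : realType) (X Y : completeNormedModType R[i]).
Variables (T : {linear (X * Y)%type -> (X * Y)%type}) (Gam rho : R).
Hypothesis Tb : sn_bounded (@sum_norm R X Y) (@sum_norm R X Y) T.
Hypothesis G0 : 0 <= Gam.
Hypothesis rho01 : 0 < rho < 1.
Hypothesis Tk : forall k z, sum_norm (iter k T z) <= Gam * rho ^+ k * sum_norm z.

(** The Neumann series of (lam - T)^-1 b converges, since T^k decays
    geometrically and |lam| = 1. *)
Lemma unimodular_resolvent lam b : cmod lam = 1 -> exists s, lam *: s = T s + b.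
Proof.
move=> lam1; have sN := seminorm_sum_norm X Y.
have lam0 : lam != 0.
  by apply/eqP => h; move: lam1; rewrite h cmod0 => /eqP; rewrite eq_sym oner_eq0.
pose S k := \sum_(j < k) lam^-1 ^+ j.+1 *: iter j T b.
have lamV j : cmod (lam^-1 ^+ j) = 1 by rewrite cmodX cmodV lam1 invr1 expr1n.
have SS k : S k.+1 = S k + lam^-1 ^+ k.+1 *: iter k T b.
  by rewrite /S big_ord_recr.
have S1 k : sum_norm (S k.+1 - S k) <= Gam * sum_norm b * rho ^+ k.
  rewrite SS [_ - S k](_ : _ = lam^-1 ^+ k.+1 *: iter k T b); last by abel.
  by rewrite (sn_scale sN) lamV mul1r mulrAC.
have c0 : 0 <= Gam * sum_norm b by rewrite mulr_ge0 // (sn_ge0 sN).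
have [l1 h1] : exists l, forall e, 0 < e -> exists N, forall k, (N <= k)%N ->
    rnorm ((S k).1 - l) < e.
  apply: (geometric_cvg rho01 c0) => k; apply: le_trans (S1 k).
  by rewrite /sum_norm lerDl rnorm_ge0.
have [l2 h2] : exists l, forall e, 0 < e -> exists N, forall k, (N <= k)%N ->
    rnorm ((S k).2 - l) < e.
  apply: (geometric_cvg rho01 c0) => k; apply: le_trans (S1 k).
  by rewrite /sum_norm lerDr rnorm_ge0.
pose s : X * Y := (l1, l2); exists s.
apply/eqP; rewrite -subr_eq0 opprD addrA; apply/eqP/sum_norm_eq0.
set d := _ - b; apply/eqP; rewrite eq_le (sn_ge0 sN) andbT.
apply/ler_addgt0Pr => e e0; rewrite add0r.
have Sk k : lam *: S k - T (S k) - b = - (lam^-1 ^+ k *: iter k T b).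
  elim: k => [|k IH]; first by rewrite /S big_ord0 scaler0 linear0 expr0 scale1r subrr add0r.
  have lamc : lam * lam^-1 ^+ k.+1 = lam^-1 ^+ k by rewrite exprS mulrA divff // mul1r.
  rewrite SS iterS; move: (lam^-1 ^+ k.+1) lamc => c lamc.
  rewrite scalerDr linearD [T (c *: _)]linearZ /= scalerA lamc.
  transitivity (lam *: S k - T (S k) - b + lam^-1 ^+ k *: iter k T b
    - c *: T (iter k T b)); first by abel.
  by rewrite IH; abel.
have [M [M0 HM]] := Tb.
pose d1 := e / (2 * (1 + M)) / 2.
have d10 : 0 < d1 by rewrite !divr_gt0 ?mulr_gt0 // ltr_pwDl.
have [N1 H1] := h1 d1 d10; have [N2 H2] := h2 d1 d10.
have e1 : 0 < e / (2 * (Gam * sum_norm b + 1)).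
  by rewrite divr_gt0 ?mulr_gt0 // ltr_pwDr.
have r01 : 0 <= rho < 1 by case/andP: rho01 => /ltW -> ->.
have [N3 H3] := exprn_lt_eventually r01 e1.
pose k := maxn N1 (maxn N2 N3).
have {}H1 := H1 k (leq_maxl _ _).
have {}H2 := H2 k (leq_trans (leq_maxl _ _) (leq_maxr _ _)).
have {}H3 := H3 k (leq_trans (leq_maxr _ _) (leq_maxr _ _)).
have dE : d = (lam *: S k - T (S k) - b) - (lam *: (S k - s) - T (S k - s)).
  rewrite scalerBr [T (_ - _)]linearB /d /=.
  by move: (lam *: s) (T s) (lam *: S k) (T (S k)) => ? ? ? ?; abel.
have q : sum_norm (S k - s) < 2 * d1.
  by have := ltrD H1 H2; rewrite /sum_norm /=; lra.
rewrite dE; apply: le_trans (sn_sub sN _ _) _.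
rewrite Sk (snN sN) (sn_scale sN) lamV mul1r.
have g1 : sum_norm (iter k T b) <= e / 2.
  apply: le_trans (Tk _ _) _; rewrite mulrAC.
  have := ler_wpM2l c0 (ltW H3) => /le_trans; apply.
  move: c0; move: (Gam * sum_norm b) => c c0.
  have -> : c * (e / (2 * (c + 1))) = e / 2 * (c / (c + 1)).
    by field; rewrite gt_eqF // ltr_pwDr.
  rewrite ler_piMr ?divr_ge0 ?(ltW e0) //.
  by rewrite ler_pdivrMr ?ltr_pwDr // mul1r lerDl.
have g2 : sum_norm (lam *: (S k - s) - T (S k - s)) <= e / 2.
  apply: le_trans (sn_sub sN _ _) _; rewrite (sn_scale sN) lam1.
  apply: (@le_trans _ _ ((1 + M) * sum_norm (S k - s))).
    by rewrite mulrDl lerD2l.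
  have M1 : 0 < 1 + M by rewrite ltr_pwDl.
  apply: le_trans (ler_wpM2l (ltW M1) (ltW q)) _.
  rewrite le_eqVlt; apply/orP; left; apply/eqP; rewrite /d1; field.
  by rewrite gt_eqF.
by lra.
Qed.

End SteadyState.

Section ClosedLoopLinear.
Variables (R : realType) (X Xd : normedModType R[i]) (p n : nat).
Variables (G : plant X p n) (K : controller Xd p).

Let closed_loop_linear : linear (closed_loop_op G K).
Proof.
move=> a x y; rewrite /closed_loop_op /=; congr (_, _).
  by rewrite !linearP /= scalerDr addrACA.
by rewrite !linearP /= !scalerDr !scalerN; abel.
Qed.
HB.instance Definition _ :=
  GRing.isLinear.Build R[i] (X * Xd)%type (X * Xd)%type _ (closed_loop_op G K)
    closed_loop_linear.

Lemma closed_loop_bounded :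
  sn_bounded (@sum_norm R X Xd) (@sum_norm R X Xd) (closed_loop_op G K).
Proof.
have sX := seminorm_rnorm X; have sd := seminorm_rnorm Xd.
have b1 : sn_bounded (@sum_norm R X Xd) (@rnorm R X) fst.
  by exists 1; split=> // x; rewrite mul1r lerDl rnorm_ge0.
have b2 : sn_bounded (@sum_norm R X Xd) (@rnorm R Xd) snd.
  by exists 1; split=> // x; rewrite mul1r lerDr rnorm_ge0.
have h1 : sn_bounded (@sum_norm R X Xd) (@rnorm R X)
    (fun z => plA G z.1 + plB G (ctR K z.2)).
  apply: sn_bounded_add => //.
    exact: (sn_bounded_comp b1 (sn_bounded_bop _)).
  have bR := sn_bounded_comp b2 (sn_bounded_bop_col (ctR K)).
  exact: (sn_bounded_comp bR (sn_bounded_column (plB G) sX)).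
have h2 : sn_bounded (@sum_norm R X Xd) (@rnorm R Xd)
    (fun z => - ctQ K (plC G z.1) + (ctP K z.2 - ctQ K (plD G *m ctR K z.2))).
  have bQ := sn_bounded_column (ctQ K) sd.
  have bC := sn_bounded_comp b1 (sn_bounded_bop_col (plC G)).
  have bR := sn_bounded_comp b2 (sn_bounded_bop_col (ctR K)).
  have bD := sn_bounded_column (mulmx (plD G)) (@seminorm_cnorm R p).
  apply: sn_bounded_add => //.
    by apply: sn_bounded_opp => //; exact: (sn_bounded_comp bC bQ).
  apply: sn_bounded_add => //.
    exact: (sn_bounded_comp b2 (sn_bounded_bop _)).
  apply: sn_bounded_opp => //.
  exact: (sn_bounded_comp (sn_bounded_comp bR bD) bQ).
case: h1 => M1 [M10 H1]; case: h2 => M2 [M20 H2].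
exists (M1 + M2); split; first exact: addr_ge0.
by move=> z; rewrite mulrDl; apply: lerD; [exact: H1 | exact: H2].
Qed.

Lemma closed_loop_stableP : closed_loop_stable G K <->
  exists Gamma rho : R, [/\ 0 <= Gamma, 0 < rho < 1 &
    forall k z, sum_norm (iter k (closed_loop_op G K) z)
      <= Gamma * rho ^+ k * sum_norm z].
Proof. exact: (power_stableP closed_loop_bounded). Qed.

End ClosedLoopLinear.

Section InternalModel.
Variables (R : realType) (X Xd : completeNormedModType R[i]) (p n : nat).
Variables (K : controller Xd p) (theta : 'I_n -> R).

Lemma cmod_expi t : cmod (expi t : R[i]) = 1.
Proof. by rewrite /cmod normc_def /= cos2Dsin2 sqrtr1. Qed.

(** The hypothesis on K is the internal model property: in a steady state at an
    exosystem frequency the controller admits no nonzero input.  Subtracting the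
    steady states leaves a trajectory of the homogeneous closed loop, which
    decays. *)
Lemma internal_model_tracking :
  (forall l xd e, expi (theta l) *: xd = ctP K xd + ctQ K e -> e = 0) ->
  forall G : plant X p n, closed_loop_stable G K -> tracking G K (exosystem_mx theta).
Proof.
move=> im G st.
pose T : {linear (X * Xd)%type -> (X * Xd)%type} := closed_loop_op G K.
have Tb : sn_bounded (@sum_norm R X Xd) (@sum_norm R X Xd) T.
  exact: closed_loop_bounded.
have [Gam [rho [G0 rho01 Tk]]] := (power_stableP Tb).1 st.
pose Bd (v : 'cV[R[i]]_n) : X * Xd :=
  (plB G (plE G *m v), ctQ K (plF G *m v - plD G *m (plE G *m v))).
pose Ce (z : X * Xd) : 'cV[R[i]]_p := - (plC G z.1 + plD G *m ctR K z.2).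
pose De (v : 'cV[R[i]]_n) : 'cV[R[i]]_p := plF G *m v - plD G *m (plE G *m v).
have CeP a x y : Ce (a *: x + y) = a *: Ce x + Ce y.
  by rewrite /Ce /= !linearP /= scalerN scalerDr; abel.
have [s Hs] : exists s : 'I_n -> X * Xd, forall l,
    expi (theta l) *: s l = T (s l) + Bd (delta_mx l 0).
  have /choice [s Hs] : forall l, exists sl,
      expi (theta l) *: sl = T sl + Bd (delta_mx l 0).
    by move=> l; apply: (unimodular_resolvent Tb G0 rho01 Tk); exact: cmod_expi.
  by exists s.
have TBd2 z v : (T z + Bd v).2 = ctP K z.2 + ctQ K (Ce z + De v).
  rewrite [ctQ K (Ce z + _)]linearD /Ce linearN /=; move: (ctQ K (De v)) => q.
  by rewrite [ctQ K (_ + _)]linearD; abel.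
have es0 l : Ce (s l) + De (delta_mx l 0) = 0.
  by apply: (im l (s l).2); rewrite -TBd2 -Hs.
pose Sg (v : 'cV[R[i]]_n) := \sum_l v l 0 *: s l.
have bC : sn_bounded (@sum_norm R X Xd) (@cnorm R p) Ce.
  have b1 : sn_bounded (@sum_norm R X Xd) (@rnorm R X) fst.
    by exists 1; split=> // x; rewrite mul1r lerDl rnorm_ge0.
  have b2 : sn_bounded (@sum_norm R X Xd) (@rnorm R Xd) snd.
    by exists 1; split=> // x; rewrite mul1r lerDr rnorm_ge0.
  have bR := sn_bounded_comp b2 (sn_bounded_bop_col (ctR K)).
  have bD := sn_bounded_column (mulmx (plD G)) (@seminorm_cnorm R p).
  apply: sn_bounded_opp; first exact: seminorm_cnorm.
  apply: sn_bounded_add; first exact: seminorm_cnorm.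
    exact: (sn_bounded_comp b1 (sn_bounded_bop_col (plC G))).
  exact: (sn_bounded_comp bR bD).
have [Mc [Mc0 HMc]] := bC.
have sN := seminorm_sum_norm X Xd.
pose Ms := \sum_l sum_norm (s l).
have Ms0 : 0 <= Ms by apply: sumr_ge0 => l _; exact: (sn_ge0 sN).
exists (Mc * Gam * (2 + Ms) + 1), rho; split=> //.
  by rewrite ltr_pwDr // !mulr_ge0 // addr_ge0.
move=> x xd xi u y ud yd v yref e [hx hy hxd hyd hxi hv hr hu he hud] k.
pose w j : X * Xd := (x j, xd j) - Sg (xi j).
have uE j : u j = ctR K (xd j) + plE G *m xi j by rewrite hu hyd hv.
have eE j : e j = Ce (x j, xd j) + De (xi j).
  rewrite he hy uE hr /Ce /De /= mulmxDr; abel.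
have DeP a c d : De (a *: c + d) = a *: De c + De d.
  by rewrite /De !linearP /= !scalerDr !scalerN; abel.
have BdP a c d : Bd (a *: c + d) = a *: Bd c + Bd d.
  congr (_, _); first by rewrite /= !linearP.
  exact: etrans (congr1 (ctQ K) (DeP a c d)) (linearP _ _ _ _).
have zS j : (x j.+1, xd j.+1) = T (x j, xd j) + Bd (xi j).
  rewrite [RHS]surjective_pairing TBd2 -eE hxd hud; congr (_, _).
  by rewrite hx uE linearD /= addrA.
have xiS j l : xi j.+1 l 0 = expi (theta l) * xi j l 0.
  by rewrite hxi mul_diag_mx !mxE.
have wS j : w j.+1 = T (w j).
  rewrite /w linearB zS /= -addrA; congr (_ + _).
  have -> : Bd (xi j) = \sum_l xi j l 0 *: Bd (delta_mx l 0).
    by rewrite {1}(column_sum_delta (xi j)) (linear_fun_sum _ _ BdP).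
  have -> : T (Sg (xi j)) = \sum_l xi j l 0 *: T (s l).
    by rewrite linear_sum; apply: eq_bigr => l _; rewrite linearZ.
  apply/eqP; rewrite subr_eq addrC -subr_eq opprK -big_split /=; apply/eqP.
  by apply: eq_bigr => l _; rewrite xiS mulrC -scalerA Hs scalerDr addrC.
have wE : w k = iter k T (w 0%N) by elim: (k) => //= j IH; rewrite wS IH.
have eC : e k = Ce (w k).
  have -> : w k = (-1) *: Sg (xi k) + (x k, xd k) by rewrite /w scaleN1r addrC.
  rewrite CeP eE scaleN1r addrC; congr (_ + _).
  have -> : De (xi k) = \sum_l xi k l 0 *: De (delta_mx l 0).
    by rewrite {1}(column_sum_delta (xi k)) (linear_fun_sum _ _ DeP).
  rewrite /Sg (linear_fun_sum _ _ CeP) -sumrN; apply: eq_bigr => l _.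
  by rewrite -scalerN -[De _](addKr (Ce (s l))) es0 addr0.
apply: le_trans (euclid_norm_le _) _; rewrite eC wE.
apply: le_trans (HMc _) _.
apply: le_trans (ler_wpM2l Mc0 (Tk _ _)) _.
have rk : 0 <= rho ^+ k by rewrite exprn_ge0 // ltW //; case/andP: rho01.
set P := pair_norm _; set E := euclid_norm _.
have E0 : 0 <= E by exact: sqrtr_ge0.
have P0 : 0 <= P by exact: sqrtr_ge0.
have w0 : sum_norm (w 0%N) <= (2 + Ms) * (P + E).
  apply: le_trans (sn_sub sN _ _) _.
  apply: (@le_trans _ _ (2 * P + Ms * E)); last first.
    by have := mulr_ge0 Ms0 P0; lra.
  apply: lerD; first exact: sum_norm_le_pair.
  apply: le_trans (sn_sum sN _ _ _) _; rewrite mulr_suml; apply: ler_sum => l _.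
  rewrite (sn_scale sN) mulrC ler_wpM2l ?(sn_ge0 sN) //.
  exact: cmod_le_euclid.
have c0 : 0 <= Mc * Gam * rho ^+ k by rewrite !mulr_ge0.
rewrite !mulrA; apply: le_trans (ler_wpM2l c0 w0) _.
have -> : Mc * Gam * rho ^+ k * ((2 + Ms) * (P + E)) =
    Mc * Gam * (2 + Ms) * rho ^+ k * (P + E) by ring.
by rewrite ler_wpM2r ?addr_ge0 // ler_wpM2r // lerDl.
Qed.

End InternalModel.

(** * Boundedness of coordinates along a closed complement *)

Section FiniteExtension.
Variables (R : realType) (X : normedModType R[i]).
Implicit Types V : set X.

Definition approx_closed V :=
  forall x, (forall e, 0 < e -> exists2 v, V v & rnorm (x - v) < e) -> V x.

Lemma closed_approx V : closed V -> approx_closed V.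
Proof.
move=> cV x h; apply: cV => B /nbhs_ballP [e e0 eB].
have eE : e = ((cmod e)%:C)%C by rewrite -cmodE gtr0_norm.
have ce : 0 < cmod e by rewrite -ltcR -eE.
have [v Vv xv] := h _ ce; exists v; split=> //; apply: eB.
by rewrite -ball_normE /= rnormE eE ltcR.
Qed.

Definition linear_set V := V 0 /\ forall a x y, V x -> V y -> V (a *: x + y).

Lemma closed_subspace_linear V : closed_subspace V -> linear_set V.
Proof.
move=> [[h0 hP] _]; split; first by move: h0; rewrite inE.
move=> a x y Vx Vy; have := hP a x y.
by rewrite !inE; apply.
Qed.

Section Adjoin.
Variables (V : set X) (b : X).
Hypotheses (Vlin : linear_set V) (Vc : approx_closed V) (bV : ~ V b).

Let VP := Vlin.2.
Let V0 := Vlin.1.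
Let VZ a x : V x -> V (a *: x).
Proof. by move=> Vx; rewrite -[_ *: _]addr0; apply: VP. Qed.
Let VB x y : V x -> V y -> V (x - y).
Proof. by move=> Vx Vy; rewrite addrC -scaleN1r; apply: VP. Qed.

(** The distance from b to V is positive because V is closed. *)
Lemma adjoin_coord_bound :
  exists2 d : R, 0 < d & forall v c, V v -> d * cmod c <= rnorm (v + c *: b).
Proof.
have [d d0 hd] : exists2 d : R, 0 < d & forall v, V v -> d <= rnorm (b - v).
  apply: contrapT => h; apply: bV; apply: Vc => e e0.
  apply: contrapT => h'; apply: h; exists e => // v Vv.
  by rewrite leNgt; apply/negP => lt; apply: h'; exists v.
exists d => // v c Vv; have [->|c0] := eqVneq c 0.
  by rewrite cmod0 mulr0 rnorm_ge0.
have -> : v + c *: b = c *: (b - (- c^-1) *: v).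
  by rewrite scaleNr opprK scalerDr scalerA divff // scale1r addrC.
by rewrite rnormZ mulrC ler_wpM2l ?cmod_ge0 //; apply/hd/VZ.
Qed.

Definition adjoin : set X := [set x | exists c, V (x - c *: b)].

Lemma adjoin_linear : linear_set adjoin.
Proof.
split; first by exists 0; rewrite scale0r subr0.
move=> a x y [c Vc'] [c' Vc'']; exists (a * c + c').
have -> : a *: x + y - (a * c + c') *: b = a *: (x - c *: b) + (y - c' *: b).
  by rewrite scalerDl -scalerA scalerDr scalerN; abel.
exact: VP.
Qed.

(** If v_k + c_k b converges, then (c_k) is Cauchy by [adjoin_coord_bound]. *)
Lemma adjoin_closed : approx_closed adjoin.
Proof.
have [d d0 hd] := adjoin_coord_bound.
move=> x hx.
have /choice [f hf] : forall k : nat, exists vc : X * R[i],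
    V vc.1 /\ rnorm (x - vc.1 - vc.2 *: b) < 2^-1 ^+ k.
  move=> k; have [|w [c Vw] xw] := hx (2^-1 ^+ k); first by rewrite exprn_gt0 ?invr_gt0.
  exists (w - c *: b, c); split=> //=.
  by rewrite opprB addrA addrAC addrK.
pose u k : ell2 R 'I_1 := [ffun _ => (f k).2].
have step k : rnorm (u k.+1 - u k) <= 2 / d * 2^-1 ^+ k.
  apply: le_trans (ell2_rnorm_le _) _; rewrite big_ord1 !ffunE.
  have [V1 h1] := hf k.+1; have [V2 h2] := hf k.
  rewrite -[leRHS]mulrAC ler_pdivlMr // mulrC.
  apply: le_trans (hd _ _ (VB V1 V2)) _.
  have -> : (f k.+1).1 - (f k).1 + ((f k.+1).2 - (f k).2) *: b =
     (x - (f k).1 - (f k).2 *: b) - (x - (f k.+1).1 - (f k.+1).2 *: b).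
    by rewrite scalerBl; abel.
  apply: le_trans (rnormB _ _) _.
  apply: le_trans (lerD (ltW h2) (ltW h1)) _.
  rewrite exprS; have : 0 < (2^-1 : R) ^+ k by rewrite exprn_gt0 ?invr_gt0.
  by move: (_ ^+ k) => q q0; lra.
have half : 0 < (2^-1 : R) < 1 by lra.
have c0 : 0 <= 2 / d by rewrite divr_ge0 ?(ltW d0).
have [l hl] := geometric_cvg half c0 step.
exists (l ord0); apply: Vc => e e0.
have B0 : 0 < rnorm b + 1 by rewrite ltr_pwDr ?rnorm_ge0.
have e2 : 0 < e / 2 by lra.
have [N hN] := hl (e / 2 / (rnorm b + 1)) (divr_gt0 e2 B0).
have half' : 0 <= (2^-1 : R) < 1 by lra.
have [N' hN'] := exprn_lt_eventually half' e2.
pose k := maxn N N'; have [Vk hk] := hf k.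
exists (f k).1 => //.
have -> : x - l ord0 *: b - (f k).1 =
    (x - (f k).1 - (f k).2 *: b) + ((f k).2 - l ord0) *: b.
  by rewrite scalerBl; abel.
apply: le_lt_trans (rnormD _ _) _; rewrite rnormZ.
have h1 := lt_trans hk (hN' k (leq_maxr _ _)).
have h2 : cmod ((f k).2 - l ord0) * rnorm b <= e / 2.
  have := hN k (leq_maxl _ _) => h.
  have := ell2_cmod_le (u k - l) ord0; rewrite !ffunE => h3.
  have := le_lt_trans h3 h; rewrite ltr_pdivlMr // => h4.
  by rewrite (le_trans _ (ltW h4)) // ler_wpM2l ?cmod_ge0 // lerDl.
by lra.
Qed.

End Adjoin.

(** Induction on m, adjoining the last vector to V; the adjoined space is closed
    again, so the first m - 1 coordinates are bounded by induction and the last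
    one by its distance to V. *)
Lemma independent_coord_bound m (b : 'I_m -> X) V :
  linear_set V -> approx_closed V ->
  (forall c : 'I_m -> R[i], V (\sum_i c i *: b i) -> forall i, c i = 0) ->
  exists M : R, 0 <= M /\ forall v (c : 'I_m -> R[i]) i, V v ->
    cmod (c i) <= M * rnorm (v + \sum_i c i *: b i).
Proof.
elim: m b V => [|m IH] b V Vlin Vc ind.
  by exists 0; split=> // v c [].
have bV : ~ V (b ord_max).
  move=> Vb; have /eqP : (1 : R[i]) = 0; last by rewrite oner_eq0.
  have := ind (fun i => (i == ord_max)%:R) _ ord_max; rewrite eqxx; apply.
  rewrite (bigD1 ord_max) //= eqxx scale1r big1 ?addr0 // => i /negbTE ->.
  by rewrite scale0r.
have [d d0 hd] := adjoin_coord_bound Vlin Vc bV.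
pose b' i := b (widen_ord (leqnSn m) i).
(* the coordinates c completed by c1 in the last position *)
pose ext (c : 'I_m -> R[i]) c1 (i : 'I_m.+1) :=
  if unlift ord_max i is Some j then c j else c1.
have extE c c1 : \sum_i ext c c1 i *: b i = \sum_i c i *: b' i + c1 *: b ord_max.
  rewrite big_ord_recr /=; congr (_ + _); last by rewrite /ext unlift_none.
  apply: eq_bigr => i _; congr (_ *: _); rewrite /ext.
  have -> : widen_ord (leqnSn m) i = lift ord_max i.
    by apply: val_inj; rewrite /= /bump leqNgt ltn_ord.
  by rewrite liftK.
have indb' : forall c : 'I_m -> R[i], adjoin V (b ord_max) (\sum_i c i *: b' i) ->
    forall i, c i = 0.
  move=> c [c1 Vc1] i.
  have := ind (ext c (- c1)); rewrite extE scaleNr => /(_ Vc1 (lift ord_max i)).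
  by rewrite /ext liftK.
have [M [M0 HM]] :=
  IH b' _ (adjoin_linear (b ord_max) Vlin) (adjoin_closed Vlin Vc bV) indb'.
pose S := \sum_i M * rnorm (b' i).
have S0 : 0 <= S by apply: sumr_ge0 => i _; rewrite mulr_ge0 // rnorm_ge0.
exists (M + (1 + S) / d); split.
  by rewrite addr_ge0 // divr_ge0 ?(ltW d0) // addr_ge0.
move=> v c i Vv; set x := v + _.
pose c' j := c (widen_ord (leqnSn m) j).
have xE : x = (v + c ord_max *: b ord_max) + \sum_j c' j *: b' j.
  by rewrite /x big_ord_recr /=; abel.
have hc' j : cmod (c' j) <= M * rnorm x.
  by rewrite xE; apply: HM; exists (c ord_max); rewrite addrK.
have x0 := rnorm_ge0 x.
case: (unliftP ord_max i) => [j ->|->].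
  have -> : lift ord_max j = widen_ord (leqnSn m) j.
    by apply: val_inj; rewrite /= /bump leqNgt ltn_ord.
  rewrite (le_trans (hc' j)) // ler_wpM2r // lerDl.
  by rewrite divr_ge0 ?(ltW d0) // addr_ge0.
apply: (@le_trans _ _ ((1 + S) / d * rnorm x)); last first.
  by rewrite ler_wpM2r // lerDr.
rewrite mulrAC ler_pdivlMr // mulrC (le_trans (hd _ _ Vv)) //.
have -> : v + c ord_max *: b ord_max = x - \sum_j c' j *: b' j by rewrite xE addrK.
rewrite mulrDl mul1r (le_trans (rnormB _ _)) // lerD2l.
rewrite (le_trans (sn_sum (seminorm_rnorm X) _ _ _)) // mulr_suml.
apply: ler_sum => j _; rewrite rnormZ mulrAC ler_wpM2r ?rnorm_ge0 //.
Qed.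

End FiniteExtension.

(** * Adapted seminorms and the Lyapunov function *)

Section FiniteDimNorm.
Import VectorInternalTheory.
Variables (R : realType) (E : vectType R[i]).

Local Notation Xd := (ell2 R 'I_(dim E)).
Definition enc (x : E) : Xd := [ffun i => v2r x 0 i].
Definition dec (f : Xd) : E := r2v (\row_i f i).

Lemma encK x : dec (enc x) = x.
Proof.
rewrite /dec (_ : (\row_i _) = v2r x) ?v2rK //.
by apply/rowP => i; rewrite mxE ffunE.
Qed.
Lemma decK f : enc (dec f) = f.
Proof. by apply/ffunP => i; rewrite ffunE /dec r2vK mxE. Qed.
Lemma enc_linear : linear enc.
Proof. by move=> a x y; apply/ffunP => i; rewrite !ffunE linearP !mxE. Qed.
Lemma dec_linear : linear dec.
Proof.
move=> a x y; rewrite /dec -linearP; congr (r2v _).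
by apply/rowP => i; rewrite !mxE !ffunE.
Qed.
HB.instance Definition _ := GRing.isLinear.Build R[i] E Xd _ enc enc_linear.
HB.instance Definition _ := GRing.isLinear.Build R[i] Xd E _ dec dec_linear.

(** A norm on any finite-dimensional space, from an arbitrary choice of
    coordinates. *)
Definition fnorm (x : E) : R := rnorm (enc x).

Lemma seminorm_fnorm : seminorm fnorm.
Proof.
split=> [x|x y|a x]; rewrite /fnorm ?rnorm_ge0 //.
  by rewrite linearD rnormD.
by rewrite linearZ rnormZ.
Qed.

Lemma sn_bounded_ell2 (I : finType) (W : lmodType R[i]) (r : W -> R)
    (f : {linear ell2 R I -> W}) : seminorm r -> sn_bounded (@rnorm R _) r f.
Proof.
move=> sr; exists (\sum_i r (f (@ell2_unit R I i))); split.
  by apply: sumr_ge0 => i _; exact: (sn_ge0 sr).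
move=> x; rewrite {1}[x]ell2_sum_unit linear_sum mulr_suml.
apply: le_trans (sn_sum sr _ _ _) _.
apply: ler_sum => i _; rewrite linearZ (sn_scale sr) mulrC.
by rewrite ler_wpM2l ?(sn_ge0 sr) //; exact: ell2_cmod_le.
Qed.

Lemma sn_bounded_fin (W : lmodType R[i]) (r : W -> R) (f : {linear E -> W}) :
  seminorm r -> sn_bounded fnorm r f.
Proof.
move=> sr; have [M [M0 HM]] := sn_bounded_ell2 (f \o dec) sr.
by exists M; split=> // x; rewrite -{1}(encK x); exact: HM.
Qed.
End FiniteDimNorm.

Section AdaptedSeminorm.
Variables (R : realType) (X : lmodType R[i]) (q : X -> R) (T : {linear X -> X}).
Variables (r : R) (M : nat).
Hypotheses (sq : seminorm q) (r0 : 0 < r) (M0 : (0 < M)%N).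

(** An equivalent seminorm for which T itself contracts by r, when T^M
    contracts by r^M. *)
Definition adapted x : R := \sum_(k < M) r^-1 ^+ k * q (iter k T x).

Lemma seminorm_adapted : seminorm adapted.
Proof.
have rk k : 0 <= r^-1 ^+ k by rewrite exprn_ge0 // invr_ge0 ltW.
split=> [x|x y|a x].
- by apply: sumr_ge0 => k _; rewrite mulr_ge0 // (sn_ge0 sq).
- rewrite /adapted -big_split; apply: ler_sum => k _ /=.
  by rewrite -mulrDr ler_wpM2l // iter_linearD (sn_add sq).
- rewrite /adapted mulr_sumr; apply: eq_bigr => k _.
  by rewrite iter_linearZ (sn_scale sq) mulrCA.
Qed.

Lemma adapted_ge x : q x <= adapted x.
Proof.
rewrite /adapted -(prednK M0) big_ord_recl /= mul1r lerDl.
apply: sumr_ge0 => k _; rewrite mulr_ge0 ?(sn_ge0 sq) //.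
by rewrite exprn_ge0 // invr_ge0 ltW.
Qed.

(** Applying T shifts the sum by one place and multiplies it by r; the new last
    term is absorbed by the dropped first one. *)
Lemma adapted_contracts x :
  q (iter M T x) <= r ^+ M * q x -> adapted (T x) <= r * adapted x.
Proof.
rewrite /adapted; case: M M0 => // m _ h.
rewrite (eq_bigr (fun k : 'I_m.+1 => r * (r^-1 ^+ k.+1 * q (iter k.+1 T x)))); last first.
  by move=> k _; rewrite -iterSr exprS !mulrA divff ?mul1r // gt_eqF.
rewrite -mulr_sumr ler_wpM2l ?(ltW r0) //.
rewrite big_ord_recr big_ord_recl /= mul1r addrC; apply: lerD; last by [].
by rewrite exprVn mulrC ler_pdivrMr ?exprn_gt0 // mulrC.
Qed.

Lemma adapted_bounded : sn_bounded q q T -> sn_bounded q adapted id.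
Proof.
case=> tau [tau0 Tt]; have rk k : 0 <= r^-1 ^+ k.
  by rewrite exprn_ge0 // invr_ge0 ltW.
exists (\sum_(k < M) r^-1 ^+ k * tau ^+ k); split.
  by apply: sumr_ge0 => k _; rewrite mulr_ge0 // exprn_ge0.
move=> x; rewrite /adapted mulr_suml; apply: ler_sum => k _.
rewrite -mulrA ler_wpM2l //; elim: (k : nat) => [|j IH]; first by rewrite mul1r.
by rewrite exprS -mulrA (le_trans (Tt _)) // ler_wpM2l.
Qed.
End AdaptedSeminorm.

(** The errors s, e, z and the register w form a cascade w -> z -> e -> s, which
    is closed by the feedback of s, e, z into w.  The gains a_i and k_i may
    be arbitrary, provided that the link from w to z is weaker than a threshold
    eps that they determine. *)
Lemma lyapunov_weights (R : realType) (r sigma mu a1 a2 a3 k1 k2 k3 : R) :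
  0 <= a1 -> 0 <= a2 -> 0 <= a3 -> 0 <= k1 -> 0 <= k2 -> 0 <= k3 ->
  r < sigma < mu ->
  exists beta gamma delta eps : R, [/\ 0 < beta, 0 < gamma, 0 < delta & 0 < eps /\
    forall s e z w s' e' z' w',
    0 <= s -> 0 <= e -> 0 <= z -> 0 <= w ->
    s' <= r * s + a1 * e + a2 * z -> e' <= r * e + a3 * z ->
    z' <= r * z + eps * w -> w' <= k1 * s + k2 * e + k3 * z + sigma * w ->
    s' + beta * e' + gamma * z' + delta * w' <=
    mu * (s + beta * e + gamma * z + delta * w)].
Proof.
move=> a10 a20 a30 k10 k20 k30 /andP[rs sm].
have mr : 0 < mu - r by lra.
have ms : 0 < mu - sigma by lra.
(* each weight is large enough to dominate, with margin mu - r, the gains out of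
   its variable that the previously chosen weights produce *)
pose delta := (mu - r) / (k1 + 1).
have k1p : 0 < k1 + 1 by lra.
have d0 : 0 < delta by rewrite divr_gt0.
pose beta := (a1 + delta * k2) / (mu - r) + 1.
have b0 : 0 < beta.
  by rewrite ltr_wpDl // divr_ge0 ?(ltW mr) // addr_ge0 // mulr_ge0 // ltW.
pose gamma := (a2 + beta * a3 + delta * k3) / (mu - r) + 1.
have g0 : 0 < gamma.
  rewrite ltr_wpDl // divr_ge0 ?(ltW mr) // !addr_ge0 // mulr_ge0 //; exact: ltW.
pose eps := (mu - sigma) * delta / gamma.
exists beta, gamma, delta, eps; split=> //; split.
  by rewrite divr_gt0 // mulr_gt0.
have c1 : r + delta * k1 <= mu.
  rewrite -lerBrDl /delta mulrAC ler_pdivrMr // ler_wpM2l ?(ltW mr) //; lra.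
have c2 : a1 + delta * k2 <= (mu - r) * beta.
  by rewrite /beta mulrDr mulrCA divff ?gt_eqF // !mulr1 lerDl ltW.
have c3 : a2 + beta * a3 + delta * k3 <= (mu - r) * gamma.
  by rewrite /gamma mulrDr mulrCA divff ?gt_eqF // !mulr1 lerDl ltW.
have c4 : gamma * eps = (mu - sigma) * delta.
  by rewrite /eps mulrC divfK // gt_eqF.
clearbody delta beta gamma eps.
move=> s e z w s' e' z' w' s0 e0 z0 w0 hs he hz hw.
have := ler_wpM2l (ltW b0) he; have := ler_wpM2l (ltW g0) hz.
have := ler_wpM2l (ltW d0) hw.
have := ler_wpM2r s0 c1; have := ler_wpM2r e0 c2; have := ler_wpM2r z0 c3.
have := congr1 (fun t => t * w) c4 => /=.
nra.
Qed.

(** With b = 1/z, resolvents at |z| > eta0 become inverses of 1 - b T on a disc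
    of radius beta > 1, where compactness makes their bounds uniform; b = 0 is
    included, so that large z need no separate treatment. *)
Lemma spectral_decay (R : realType) (X : normedModType R[i]) (V : set X)
    (T : bounded_op X X) (eta0 : R) :
  linear_set V -> maps_into_self T V -> 0 < eta0 < 1 ->
  (forall z, eta0 < cmod z -> resolvent_set_on V T z) ->
  exists M r, [/\ (0 < M)%N, 0 < r < 1 &
    forall x, V x -> rnorm (iter M T x) <= r ^+ M * rnorm x].
Proof.
move=> Vlin TV /andP[e0 e1] res; have [V0 VP] := Vlin.
have [tau [tau0 Tb]] := bop_bound T.
pose beta := 2 / (1 + eta0).
have beta0 : 0 < beta by rewrite divr_gt0 //; lra.
have beta1 : 1 < beta by rewrite ltr_pdivlMr; lra.
have inv b : b != 0 -> cmod b <= beta -> eta0 < cmod b^-1.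
  move=> b0 bb; have cb : 0 < cmod b.
    rewrite lt_def cmod_ge0 andbT; apply: contra b0 => /eqP/cmod_eq0 ->.
    exact: eqxx.
  rewrite cmodV; apply: (@lt_le_trans _ _ beta^-1).
    by rewrite invf_div ltr_pdivlMr; lra.
  by rewrite lef_pV2 ?posrE.
have VZ a x : V x -> V (a *: x).
  by move=> Vx; rewrite -[_ *: _]addr0; apply: VP.
have below b : cmod b <= beta -> exists C, 0 < C /\ forall x, V x ->
    rnorm x <= C * rnorm (x - b *: T x).
  have [->|b0] := eqVneq b 0 => bb.
    by exists 1; split=> // x _; rewrite scale0r subr0 mul1r.
  have [S [_ _ [M HM] h1 _]] := res _ (inv _ b0 bb).
  exists (Num.max M 1 * cmod b^-1); split.
    by rewrite mulr_gt0 ?lt_max ?ltr01 ?orbT // (lt_trans e0) // inv.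
  move=> x Vx; rewrite -mulrA -rnormZ scalerBr scalerA mulVf // scale1r.
  have Vy : V (b^-1 *: x - T x).
    by rewrite addrC -scaleN1r; apply: VP; [exact: TV | exact: VZ].
  rewrite -{1}(h1 x Vx); apply: le_trans (HM _ Vy) _.
  by rewrite ler_wpM2r ?rnorm_ge0 // le_max lexx.
have [C HC] : exists C, forall b, cmod b <= beta -> forall x, V x ->
    rnorm x <= C * rnorm (x - b *: T x).
  apply: (uniform_on_disc (P := fun C b => forall x, V x ->
    rnorm x <= C * rnorm (x - b *: T x))) => [C C' b CC h x Vx|b bb].
    by rewrite (le_trans (h _ Vx)) // ler_wpM2r // rnorm_ge0.
  have [C [C0 hC]] := below b bb.
  exists (2 * C), (2 * C * tau)^-1; split; first by rewrite invr_gt0 !mulr_gt0.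
  move=> b' b'b close x Vx.
  have h := hC x Vx.
  have h2 : rnorm (x - b *: T x) <= rnorm (x - b' *: T x) + cmod (b' - b) * (tau * rnorm x).
    have -> : x - b *: T x = (x - b' *: T x) + (b' - b) *: T x.
      by rewrite scalerBl; abel.
    rewrite (le_trans (rnormD _ _)) // lerD2l rnormZ ler_wpM2l ?cmod_ge0 //.
  have h3 : C * (cmod (b' - b) * (tau * rnorm x)) <= rnorm x / 2.
    have : cmod (b' - b) * (2 * C * tau) <= 1.
      by rewrite -ler_pdivlMr ?mulr_gt0 // div1r ltW.
    move=> /(ler_wpM2r (rnorm_ge0 x)); rewrite mul1r => hh.
    have -> : C * (cmod (b' - b) * (tau * rnorm x)) =
        cmod (b' - b) * (2 * C * tau) * rnorm x / 2 by field.
    by rewrite ler_pM2r.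
  have := ler_wpM2l (ltW C0) h2; rewrite mulrDr => h4.
  rewrite -mulrA; move: h h3 h4.
  move: (C * rnorm (x - b *: T x)) (C * rnorm (x - b' *: T x)) (C * _) (rnorm x).
  by move=> t1 t2 t3 t4; lra.
have surj b : cmod b <= beta -> forall x, V x -> exists2 y, V y & y - b *: T y = x.
  have [->|b0] := eqVneq b 0 => bb x Vx.
    by exists x => //; rewrite scale0r subr0.
  have [S [SV _ _ _ h2]] := res _ (inv _ b0 bb).
  exists (S (b^-1 *: x)); first by apply/SV/VZ.
  have := congr1 (fun t => b *: t) (h2 _ (VZ b^-1 x Vx)).
  by rewrite scalerBr !scalerA divff // !scale1r.
apply: (dyadic_decay (C := Num.max C 1) (beta := beta) (tau := tau)) => //.
- by rewrite lt_max ltr01 orbT.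
- exact: ltW.
move=> b bb x Vx; rewrite (le_trans (HC b bb x Vx)) // ler_wpM2r ?rnorm_ge0 //.
by rewrite le_max lexx.
Qed.

Lemma expi_inj (R : realType) (t s : R) :
  0 <= t < 2 * pi -> 0 <= s < 2 * pi -> expi t = expi s -> t = s.
Proof.
wlog ts : t s / s <= t.
  move=> H ht hs h; case: (lerP s t) => [le|/ltW le]; first exact: H.
  by apply/esym; apply: H.
move=> /andP[t0 t1] /andP[s0 s1] [hc hs].
have : cos (t - s) = 1 by rewrite cosB hc hs -!expr2 cos2Dsin2.
set d := t - s => hd; have d0 : 0 <= d by rewrite subr_ge0.
have d1 : d < 2 * pi by rewrite /d; lra.
apply/eqP; rewrite -subr_eq0 -/d; apply: contraT => dn0.
have dh : d = (d / 2) *+ 2 by rewrite -mulr_natr divfK.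
have sp : 0 < sin (d / 2).
  have dp : 0 < d by rewrite lt_def dn0.
  by apply: sin_gt0_pi; lra.
have := cos2Dsin2 (d / 2); have := exprn_gt0 2 sp.
by move: hd; rewrite {1}dh cos_mulr2n; lra.
Qed.

(** * The controller and its error coordinates *)

Section Bundle.
Variables (K : pzRingType) (V W : lmodType K) (f : V -> W) (fP : linear f).
(** Turns a function with a linearity proof into a linear map where no
    canonical structure applies. *)
Definition bundle : {linear V -> W} :=
  HB.pack f (GRing.isLinear.Build K V W _ f fP).
Lemma bundleE x : bundle x = f x. Proof. by []. Qed.
End Bundle.

Section Controller.
Variables (R : realType) (X : hilbertType R) (p n m N : nat).
Variables (G : plant X p n) (b : 'I_m -> X) (xp : {linear X -> 'cV[R[i]]_m}).
Variables (lam : 'I_n -> R[i]) (res : 'I_n -> {linear X -> X}).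
Variables (Ap : 'M[R[i]]_m) (Bp : 'M[R[i]]_(m, p)) (Cp : 'M[R[i]]_(p, m)).
Variables (H : 'I_n -> 'M[R[i]]_p) (L : 'M[R[i]]_(m, p)).

Local Notation A := (plA G).
Local Notation B := (plB G).
Local Notation C := (plC G).
Local Notation D := (plD G).
Local Notation U := 'cV[R[i]]_p.
Local Notation S := ('cV[R[i]]_m * {ffun 'I_n -> U})%type.
Local Notation register := {ffun 'I_N.+1 -> U}.
Local Notation E := (S * register)%type.

Variable K : {linear S -> U}.

Definition emb (c : 'cV[R[i]]_m) : X := \sum_i c i 0 *: b i.
Definition stable_part (x : X) : X := x - emb (xp x).
(** Approximation of the stable part of the state by the last N+1 inputs,
    w j being the input applied j+1 steps ago. *)
Definition recall (w : register) : X := \sum_(j < N.+1) iter j A (stable_part (B (w j))).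
(** Estimates of x+ and of v_l = q_l - C (lam_l - A)^-1 x from the controller
    state y = ((x+ estimate, q), register). *)
Definition estimate (y : E) : S :=
  (y.1.1, [ffun l => y.1.2 l - C (res l (emb y.1.1 + recall y.2))]).
Definition ctl_out (y : E) : U := K (estimate y).
Definition shift (u : U) (w : register) : register :=
  [ffun j => if unlift ord0 j is Some i then w (widen_ord (leqnSn N) i) else u].
Definition ctl_step (y : E) : E :=
  (Ap *m y.1.1 + Bp *m ctl_out y
     + L *m (C (emb y.1.1 + recall y.2) + D *m ctl_out y),
   [ffun l => lam l *: y.1.2 l],
   shift (ctl_out y) y.2).
Definition ctl_in (e : U) : E := (L *m e, [ffun=> e], 0).

Lemma emb_linear : linear emb.
Proof.
move=> a x y; rewrite /emb scaler_sumr -big_split; apply: eq_bigr => i _ /=.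
by rewrite !mxE scalerDl scalerA.
Qed.
Lemma stable_part_linear : linear stable_part.
Proof.
move=> a x y; rewrite /stable_part linearP emb_linear scalerDr scalerN; abel.
Qed.
Lemma recall_linear : linear recall.
Proof.
move=> a x y; rewrite /recall scaler_sumr -big_split; apply: eq_bigr => i _ /=.
by rewrite !ffunE linearP stable_part_linear iter_linearP.
Qed.
Lemma estimate_linear : linear estimate.
Proof.
move=> a x y; congr (_, _); apply/ffunP => l; rewrite !ffunE /=.
rewrite emb_linear recall_linear.
set u := emb _; set v := emb _; set u' := recall _; set v' := recall _.
have -> : a *: u + v + (a *: u' + v') = a *: (u + u') + (v + v').
  by rewrite scalerDr; abel.
by rewrite !linearP /= scalerDr scalerN; abel.
Qed.
Lemma ctl_out_linear : linear ctl_out.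
Proof. by move=> a x y; rewrite /ctl_out estimate_linear linearP. Qed.
Lemma ctl_step_linear : linear ctl_step.
Proof.
move=> a x y; rewrite /ctl_step ctl_out_linear; congr (_, _, _); last first.
- apply/ffunP => j; rewrite !ffunE /=; case: unliftP => // i _.
  by rewrite !ffunE.
- by apply/ffunP => l; rewrite !ffunE scalerDr !scalerA mulrC.
rewrite /= emb_linear recall_linear.
set u := emb _; set v := emb _; set u' := recall _; set v' := recall _.
have -> : a *: u + v + (a *: u' + v') = a *: (u + u') + (v + v').
  by rewrite scalerDr; abel.
set s := ctl_out x; set t := ctl_out y.
have -> : C (a *: (u + u') + (v + v')) + D *m (a *: s + t) =
    a *: (C (u + u') + D *m s) + (C (v + v') + D *m t).
  by rewrite !linearP scalerDr /=; abel.
by rewrite !linearP /= !scalerDr; abel.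
Qed.
Lemma ctl_in_linear : linear ctl_in.
Proof.
move=> a x y; congr (_, _, _); first by rewrite /= linearP.
  by apply/ffunP => l; rewrite !ffunE.
by rewrite /= scaler0 addr0.
Qed.

Definition loop (z : X * E) : X * E :=
  (A z.1 + B (ctl_out z.2),
   ctl_step z.2 + ctl_in (- (C z.1 + D *m ctl_out z.2))).

(** The exact values of what [estimate] approximates. *)
Definition modes (z : X * E) : S := (xp z.1, [ffun l => z.2.1.2 l - C (res l z.1)]).
Definition est_err (z : X * E) : 'cV[R[i]]_m := xp z.1 - z.2.1.1.
Definition stable_err (z : X * E) : X := stable_part z.1 - recall z.2.2.
(** The difference between [estimate] and [modes], in terms of the observer
    error e and of the error x on the stable part. *)
Definition mismatch (e : 'cV[R[i]]_m) (x : X) : S :=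
  (- e, [ffun l => C (res l (emb e + x))]).

Hypothesis embA : forall c, A (emb c) = emb (Ap *m c).
Hypothesis xpA : forall x, xp (A x) = Ap *m xp x.
Hypothesis xpB : forall u, xp (B u) = Bp *m u.
Hypothesis CE : forall c, C (emb c) = Cp *m c.
Hypothesis resA : forall l x, res l (lam l *: x - A x) = x.
Hypothesis HE : forall l u, H l *m u = C (res l (B u)) + D *m u.

Lemma stable_partA x : stable_part (A x) = A (stable_part x).
Proof. by rewrite /stable_part xpA -embA linearB. Qed.

Lemma emb_est_err z : emb (est_err z) = emb (xp z.1) - emb z.2.1.1.
Proof.
by rewrite /est_err -[xp z.1 - _]addrC -scaleN1r emb_linear scaleN1r addrC.
Qed.

Lemma ctl_outE z :
  ctl_out z.2 = K (modes z) + K (mismatch (est_err z) (stable_err z)).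
Proof.
rewrite -linearD /ctl_out; congr (K _); congr (_, _).
  by rewrite /= /est_err opprB addrC subrK.
apply/ffunP => l; rewrite !ffunE.
have -> : emb z.2.1.1 + recall z.2.2 = z.1 - (emb (est_err z) + stable_err z).
  by rewrite emb_est_err /stable_err /stable_part; abel.
by rewrite !linearB /=; abel.
Qed.

(** The stable part of the plant disappears from the equation of v_l because
    C (lam_l - A)^-1 A = lam_l C (lam_l - A)^-1 - C. *)
Lemma modes_loop z : modes (loop z) =
  modal_step Ap lam (modes z) + modal_input Bp H (ctl_out z.2).
Proof.
congr (_, _); first by rewrite linearD xpA xpB.
apply/ffunP => l; rewrite !ffunE /= HE; set u := ctl_out _.
have e : res l (A z.1) = lam l *: res l z.1 - z.1.
  by rewrite -[in X in _ = _ - X](resA l z.1) linearB linearZ /=; abel.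
have -> : C (res l (A z.1 + B u)) = lam l *: C (res l z.1) - C z.1 + C (res l (B u)).
  by rewrite [res l (_ + _)]linearD e !linearD linearN linearZ.
by rewrite scalerBr; abel.
Qed.

Lemma est_err_loop z : est_err (loop z) =
  (Ap + L *m Cp) *m est_err z + L *m C (stable_err z).
Proof.
rewrite {1}/est_err /= linearD xpA xpB; set u := ctl_out _.
have -> : C (stable_err z) = C z.1 - Cp *m est_err z - C (emb z.2.1.1 + recall z.2.2).
  rewrite -CE -linearB -linearB; congr (C _).
  by rewrite emb_est_err /stable_err /stable_part; abel.
rewrite mulmxDl {1}/est_err !mulmxBr -!mulmxA !mulmxDr !mulmxN !mulmxDr.
by abel.
Qed.

(** Shifting the register reproduces one step of the stable dynamics except for
    the input that drops out of it. *)
Lemma stable_err_loop z : stable_err (loop z) =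
  A (stable_err z) + iter N.+1 A (stable_part (B (z.2.2 ord_max))).
Proof.
rewrite {1}/stable_err /= addr0; set u := ctl_out _.
have -> : recall (shift u z.2.2) = stable_part (B u) + A (recall z.2.2)
    - iter N.+1 A (stable_part (B (z.2.2 ord_max))).
  have -> : A (recall z.2.2) = \sum_(i < N) iter i.+1 A
      (stable_part (B (z.2.2 (widen_ord (leqnSn N) i)))) + iter N.+1 A (stable_part (B (z.2.2 ord_max))).
    by rewrite /recall big_ord_recr linearD linear_sum.
  rewrite /recall big_ord_recl ffunE unlift_none /= addrA addrK; congr (_ + _).
  by apply: eq_bigr => i _; rewrite ffunE liftK.
have -> : stable_part (A z.1 + B u) = stable_part (A z.1) + stable_part (B u).
  by rewrite -[A z.1]scale1r stable_part_linear !scale1r.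
have -> : A (stable_err z) = A (stable_part z.1) - A (recall z.2.2) by exact: linearB.
by rewrite stable_partA; abel.
Qed.

End Controller.

(** * Decay of the closed loop *)

Section MoreBounded.
Variable R : realType.

Lemma sn_bounded_ext (V W : lmodType R[i]) (q : V -> R) (r : W -> R) f g :
  (forall x, f x = g x) -> sn_bounded q r f -> sn_bounded q r g.
Proof. by move=> fg [M [M0 HM]]; exists M; split=> // x; rewrite -fg. Qed.

Lemma sn_bounded_le (V W : lmodType R[i]) (q q' : V -> R) (r : W -> R) f :
  (forall x, q x <= q' x) -> sn_bounded q r f -> sn_bounded q' r f.
Proof.
move=> qq [M [M0 HM]]; exists M; split=> // x.
by rewrite (le_trans (HM x)) // ler_wpM2l.
Qed.

Variables (p : nat) (I : finType).
Local Notation F := {ffun I -> 'cV[R[i]]_p}.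

Definition one_at (i : I) (u : 'cV[R[i]]_p) : F := [ffun j => if j == i then u else 0].

Lemma one_at_linear i : linear (one_at i).
Proof.
move=> a u v; apply/ffunP => j; rewrite !ffunE; case: eqP => // _.
by rewrite scaler0 addr0.
Qed.

Lemma ffun_sum_one_at (w : F) : w = \sum_i one_at i (w i).
Proof.
apply/ffunP => j; rewrite sum_ffunE (bigD1 j) //= ffunE eqxx big1 ?addr0 //.
by move=> i ij; rewrite ffunE eq_sym (negbTE ij).
Qed.

(** A family of vectors is handled one member at a time, through [one_at]. *)
Lemma sn_bounded_family (V W : lmodType R[i]) (q : V -> R) (r : W -> R)
    (f : {linear F -> W}) (g : I -> V -> 'cV[R[i]]_p) :
  seminorm r -> (forall i, sn_bounded q (@cnorm R p) (g i)) ->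
  sn_bounded q r (fun x => f [ffun i => g i x]).
Proof.
move=> sr hg.
apply: (@sn_bounded_ext _ _ _ _ (fun x => \sum_i f (one_at i (g i x)))).
  move=> x; rewrite [in RHS](ffun_sum_one_at [ffun i => g i x]) linear_sum.
  by apply: eq_bigr => i _; rewrite ffunE.
apply: sn_bounded_sum => // i.
exact: (sn_bounded_comp (hg i) (sn_bounded_column (f \o bundle (one_at_linear i)) sr)).
Qed.

Lemma seminorm_weighted (c : I -> R) : (forall i, 0 <= c i) ->
  seminorm (fun w : F => \sum_i c i * cnorm (w i)).
Proof.
move=> c0; have sc := @seminorm_cnorm R p; split=> [w|w w'|a w].
- by apply: sumr_ge0 => i _; rewrite mulr_ge0 // (sn_ge0 sc).
- rewrite -big_split; apply: ler_sum => i _ /=.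
  by rewrite -mulrDr ler_wpM2l // ffunE (sn_add sc).
- rewrite mulr_sumr; apply: eq_bigr => i _.
  by rewrite ffunE (sn_scale sc) mulrCA.
Qed.

End MoreBounded.

Section Stability.
Variables (R : realType) (X : hilbertType R) (p n m : nat).
Variables (G : plant X p n) (b : 'I_m -> X) (xp : {linear X -> 'cV[R[i]]_m}).
Variables (lam : 'I_n -> R[i]) (res : 'I_n -> {linear X -> X}).
Variables (Ap : 'M[R[i]]_m) (Bp : 'M[R[i]]_(m, p)) (Cp : 'M[R[i]]_(p, m)).
Variables (H : 'I_n -> 'M[R[i]]_p) (L : 'M[R[i]]_(m, p)).
Local Notation A := (plA G).
Local Notation B := (plB G).
Local Notation C := (plC G).
Local Notation D := (plD G).
Local Notation U := 'cV[R[i]]_p.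
Local Notation S := ('cV[R[i]]_m * {ffun 'I_n -> U})%type.
Local Notation E N := (S * {ffun 'I_N.+1 -> U})%type.
Variable K : {linear S -> U}.

Hypothesis embA : forall c, A (emb b c) = emb b (Ap *m c).
Hypothesis xpA : forall x, xp (A x) = Ap *m xp x.
Hypothesis xpB : forall u, xp (B u) = Bp *m u.
Hypothesis CE : forall c, C (emb b c) = Cp *m c.
Hypothesis resA : forall l x, res l (lam l *: x - A x) = x.
Hypothesis HE : forall l u, H l *m u = C (res l (B u)) + D *m u.

Variables (Xm : set X) (M kL kK : nat) (r : R).
Hypothesis xp_bd : sn_bounded (@rnorm R X) (@cnorm R m) xp.
Hypothesis res_bd : forall l, sn_bounded (@rnorm R X) (@rnorm R X) (res l).
Hypothesis XmA : maps_into_self A Xm.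
Hypothesis Xm_lin : linear_set Xm.
Hypothesis stable_partX : forall x, Xm (stable_part b xp x).
Hypothesis M0 : (0 < M)%N.
Hypothesis r01 : 0 < r < 1.
Hypothesis decay : forall x, Xm x -> rnorm (iter M A x) <= r ^+ M * rnorm x.
Hypothesis nilL : forall e : 'cV[R[i]]_m, iter kL (mulmx (Ap + L *m Cp)) e = 0.
Hypothesis nilK : forall s,
  iter kK (fun s => modal_step Ap lam s + modal_input Bp H (K s)) s = 0.

Let r0 : 0 < r. Proof. by case/andP: r01. Qed.

Lemma modal_step_lin : linear (modal_step Ap lam : S -> S).
Proof.
move=> a x y; congr (_, _); first by rewrite /= linearP.
by apply/ffunP=> l; rewrite !ffunE scalerDr !scalerA mulrC.
Qed.
Lemma modal_input_lin : linear (modal_input Bp H : U -> S).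
Proof.
move=> a x y; congr (_, _); first by rewrite /= linearP.
by apply/ffunP=> l; rewrite !ffunE linearP opprD scalerN.
Qed.

Definition cl_modes (s : S) : S := modal_step Ap lam s + modal_input Bp H (K s).
Lemma cl_modes_linear : linear cl_modes.
Proof.
move=> a x y; rewrite /cl_modes (linearP K a x y) modal_step_lin.
by rewrite modal_input_lin scalerDr addrACA.
Qed.

(** Seminorms adapted to the controlled modes, to the observer error, and to A
    on the stable part. *)
Definition nuS := adapted (@fnorm R S) (bundle cl_modes_linear) r kK.+1.
Definition nuE := adapted (@cnorm R m) (mulmx (Ap + L *m Cp)) r kL.+1.
Definition nuZ := adapted (@rnorm R X) A r M.

Lemma seminorm_nuS : seminorm nuS.
Proof. exact: seminorm_adapted (seminorm_fnorm _) r0. Qed.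
Lemma seminorm_nuE : seminorm nuE.
Proof. exact: seminorm_adapted (@seminorm_cnorm R m) r0. Qed.
Lemma seminorm_nuZ : seminorm nuZ.
Proof. exact: seminorm_adapted (seminorm_rnorm X) r0. Qed.

Lemma nuS_contracts s : nuS (cl_modes s) <= r * nuS s.
Proof.
apply: (adapted_contracts (T := bundle cl_modes_linear) r0) => //.
have -> : iter kK.+1 (bundle cl_modes_linear) s = 0.
  by rewrite iterSr; exact: nilK.
rewrite (sn0 (seminorm_fnorm _)) mulr_ge0 ?exprn_ge0 ?(ltW r0) //.
exact: sn_ge0 (seminorm_fnorm _) _.
Qed.

Lemma nuE_contracts e : nuE ((Ap + L *m Cp) *m e) <= r * nuE e.
Proof.
apply: (adapted_contracts r0) => //.
rewrite iterSr nilL (sn0 (@seminorm_cnorm R m)) mulr_ge0 ?exprn_ge0 ?(ltW r0) //.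
exact: sn_ge0 (@seminorm_cnorm R m) _.
Qed.

Lemma nuZ_contracts x : Xm x -> nuZ (A x) <= r * nuZ x.
Proof. by move=> Xx; apply: (adapted_contracts r0) => //; exact: decay. Qed.

Lemma rnorm_le_nuZ x : rnorm x <= nuZ x.
Proof. exact: adapted_ge (seminorm_rnorm X) r0 M0 x. Qed.

Lemma nuZ_bd : sn_bounded (@rnorm R X) nuZ id.
Proof. exact: adapted_bounded (sn_bounded_bop A). Qed.

Let cpl (v : {ffun 'I_n -> U}) : S := (0, v).
Let cpl_linear : linear cpl.
Proof. by move=> a x y; congr (_, _); rewrite /= scaler0 addr0. Qed.
Let mm0_linear : linear (fun e => mismatch G b res e 0).
Proof.
move=> a x y; congr (_, _); first by rewrite /= opprD scalerN.
by apply/ffunP => l; rewrite !ffunE !addr0 emb_linear !linearP.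
Qed.

Lemma cnorm_le_nuE e : cnorm e <= nuE e.
Proof. exact: (adapted_ge _ (@seminorm_cnorm R m) r0 (ltn0Sn kL)). Qed.

Lemma CR_bd l : sn_bounded nuZ (@cnorm R p) (fun x => C (res l x)).
Proof.
apply: (sn_bounded_le rnorm_le_nuZ).
exact: (sn_bounded_comp (res_bd l) (sn_bounded_bop_col C)).
Qed.

Lemma mismatch_bound (W : lmodType R[i]) (s : W -> R) (f : {linear S -> W}) :
  seminorm s -> exists c d, [/\ 0 <= c, 0 <= d & forall e x,
    s (f (mismatch G b res e x)) <= c * nuE e + d * nuZ x].
Proof.
move=> ss.
have [c [c0 hc]] := sn_bounded_le cnorm_le_nuE
  (sn_bounded_column (f \o bundle mm0_linear) ss).
have [d [d0 hd]] := sn_bounded_family (f \o bundle cpl_linear) ss CR_bd.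
exists c, d; split=> // e x.
have -> : mismatch G b res e x =
    mismatch G b res e 0 + cpl [ffun l => C (res l x)].
  congr (_, _); first by rewrite /= addr0.
  by apply/ffunP => l; rewrite !ffunE addr0 !linearD.
rewrite linearD (le_trans (sn_add ss _ _)) // lerD //.
  exact: hc.
exact: hd.
Qed.

Section Lyapunov.
Variables (N : nat) (sigma beta gamma delta : R).
Hypotheses (sg0 : 0 < sigma) (be0 : 0 < beta) (ga0 : 0 < gamma) (de0 : 0 < delta).

Local Notation Z := (X * E N)%type.
(** Shifting the register multiplies this norm by sigma, up to the incoming
    value. *)
Definition nuW (w : {ffun 'I_N.+1 -> U}) : R := \sum_(j < N.+1) sigma ^+ j * cnorm (w j).
Definition lyap (z : Z) : R := nuS (modes G xp res z) + beta * nuE (est_err xp z)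
  + gamma * nuZ (stable_err G b xp z) + delta * nuW z.2.2.
Definition znorm (z : Z) : R := rnorm z.1 + fnorm z.2.

Lemma seminorm_nuW : seminorm nuW.
Proof. by apply: seminorm_weighted => j; rewrite exprn_ge0 // ltW. Qed.

Lemma seminorm_znorm : seminorm znorm.
Proof.
have s1 := seminorm_rnorm X; have s2 := seminorm_fnorm (E N).
split=> [z|z z'|a z].
- by rewrite addr_ge0 ?(sn_ge0 s1) ?(sn_ge0 s2).
- by rewrite /znorm addrACA lerD ?(sn_add s1) ?(sn_add s2).
- by rewrite /znorm (sn_scale s1) (sn_scale s2) mulrDr.
Qed.

Lemma nuW_last (w : {ffun 'I_N.+1 -> U}) : cnorm (w ord_max) <= sigma^-1 ^+ N * nuW w.
Proof.
rewrite exprVn mulrC ler_pdivlMr ?exprn_gt0 // mulrC /nuW big_ord_recr /= lerDr.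
apply: sumr_ge0 => j _; rewrite mulr_ge0 ?exprn_ge0 ?(ltW sg0) //.
exact: sn_ge0 (@seminorm_cnorm R p) _.
Qed.

Lemma nuW_shift u (w : {ffun 'I_N.+1 -> U}) : nuW (shift u w) <= cnorm u + sigma * nuW w.
Proof.
rewrite /nuW big_ord_recl ffunE unlift_none mul1r lerD2l.
rewrite [in leRHS]big_ord_recr mulrDr /= mulr_sumr.
apply: (@le_trans _ _ (\sum_(i < N) sigma * (sigma ^+ i * cnorm (w (widen_ord (leqnSn N) i))))).
  by apply: ler_sum => i _; rewrite ffunE liftK exprS mulrA.
rewrite lerDl !mulr_ge0 ?exprn_ge0 ?(ltW sg0) //.
exact: sn_ge0 (@seminorm_cnorm R p) _.
Qed.

Let fst_bd : sn_bounded znorm (@rnorm R X) fst.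
Proof.
exists 1; split=> // z; rewrite mul1r lerDl.
exact: sn_ge0 (seminorm_fnorm (E N)) _.
Qed.
Let snd_bd : sn_bounded znorm (@fnorm R (E N)) snd.
Proof. by exists 1; split=> // z; rewrite mul1r lerDr rnorm_ge0. Qed.

Let getx (y : E N) := y.1.1.
Let getq (y : E N) : S := (0, y.1.2).
Let getw (y : E N) := y.2.
Let getx_linear : linear getx. Proof. by []. Qed.
Let getq_linear : linear getq.
Proof. by move=> a x y; congr (_, _); rewrite /= scaler0 addr0. Qed.
Let getw_linear : linear getw. Proof. by []. Qed.
Let putx (c : 'cV[R[i]]_m) : E N := ((c, 0), 0).
Let putq (v : {ffun 'I_n -> U}) : E N := ((0, v), 0).
Let putw (w : {ffun 'I_N.+1 -> U}) : E N := (0, w).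
Let putx_linear : linear putx.
Proof. by move=> a x y; congr (_, _, _); rewrite /= scaler0 addr0. Qed.
Let putq_linear : linear putq.
Proof. by move=> a x y; congr (_, _, _); rewrite /= scaler0 addr0. Qed.
Let putw_linear : linear putw.
Proof. by move=> a x y; congr (_, _); rewrite /= scaler0 addr0. Qed.
Let cst (c : 'cV[R[i]]_m) : S := (c, 0).
Let cst_linear : linear cst.
Proof. by move=> a x y; congr (_, _); rewrite /= scaler0 addr0. Qed.
Let recall_lin := bundle (@recall_linear R X p n m N G b xp).

Lemma lyap_le_znorm : exists c, 0 <= c /\ forall z, lyap z <= c * znorm z.
Proof.
have sZ := seminorm_nuZ; have sS := seminorm_nuS; have sE := seminorm_nuE.
have sW := seminorm_nuW; have sN := seminorm_znorm.
have xpz := sn_bounded_comp fst_bd xp_bd.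
have [c1 [c10 h1]] : sn_bounded znorm nuS (@modes R X p n m N G xp res).
  apply: (@sn_bounded_ext _ _ _ _ _ (fun z => (cst (xp z.1) + getq z.2)
      + - cpl [ffun l => C (res l z.1)])).
    move=> z; congr (_, _); first by rewrite /= !addr0 subr0.
    by apply/ffunP => l; rewrite !ffunE add0r.
  apply: sn_bounded_add => //; first apply: sn_bounded_add => //.
  - exact: (sn_bounded_comp xpz (sn_bounded_column (bundle cst_linear) sS)).
  - exact: (sn_bounded_comp snd_bd (sn_bounded_fin (bundle getq_linear) sS)).
  - apply: sn_bounded_opp => //.
    apply: (sn_bounded_family (bundle cpl_linear)) => // l.
    exact: (sn_bounded_comp fst_bd
      (sn_bounded_comp (res_bd l) (sn_bounded_bop_col C))).
have [c2 [c20 h2]] : sn_bounded znorm nuE (@est_err R X p n m N xp).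
  apply: sn_bounded_add => //.
    exact: (sn_bounded_comp xpz (sn_bounded_column idfun sE)).
  apply: sn_bounded_opp => //.
  exact: (sn_bounded_comp snd_bd (sn_bounded_fin (bundle getx_linear) sE)).
have [c3 [c30 h3]] : sn_bounded znorm nuZ (@stable_err R X p n m N G b xp).
  apply: sn_bounded_add => //; first apply: sn_bounded_add => //.
  - exact: (sn_bounded_comp fst_bd nuZ_bd).
  - apply: sn_bounded_opp => //.
    exact: (sn_bounded_comp xpz (sn_bounded_column (bundle (emb_linear b)) sZ)).
  - apply: sn_bounded_opp => //.
    exact: (sn_bounded_comp snd_bd
      (sn_bounded_fin (recall_lin \o bundle getw_linear) sZ)).
have [c4 [c40 h4]] : sn_bounded znorm nuW (fun z => z.2.2).
  exact: (sn_bounded_comp snd_bd (sn_bounded_fin (bundle getw_linear) sW)).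
exists (c1 + beta * c2 + gamma * c3 + delta * c4); split.
  by rewrite !addr_ge0 // mulr_ge0 // ltW.
move=> z; rewrite !mulrDl -!mulrA /lyap.
by rewrite !lerD // ler_wpM2l // ltW.
Qed.

(** State and controller are recovered from the error coordinates: x from the
    modes, the stable error and the register, then q from the modes and x. *)
Lemma znorm_le_lyap : exists c, 0 <= c /\ forall z, znorm z <= c * lyap z.
Proof.
have sZ := seminorm_nuZ; have sS := seminorm_nuS; have sE := seminorm_nuE.
have sW := seminorm_nuW; have sN := seminorm_znorm.
have sX := seminorm_rnorm X; have sF := seminorm_fnorm (E N).
have p1 z : 0 <= nuS (modes G xp res z) := sn_ge0 sS _.
have p2 (z : Z) : 0 <= beta * nuE (est_err xp z).
  by rewrite mulr_ge0 ?(sn_ge0 sE) // ltW.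
have p3 z : 0 <= gamma * nuZ (stable_err G b xp z).
  by rewrite mulr_ge0 ?(sn_ge0 sZ) // ltW.
have p4 (z : Z) : 0 <= delta * nuW z.2.2.
  by rewrite mulr_ge0 ?(sn_ge0 sW) // ltW.
have b1 : sn_bounded lyap (@fnorm R S) (@modes R X p n m N G xp res).
  exists 1; split=> // z; rewrite mul1r /lyap.
  have h := adapted_ge (bundle cl_modes_linear) (M := kK.+1) (seminorm_fnorm _) r0 (ltn0Sn kK) (modes G xp res z).
  by rewrite -!addrA (le_trans h) // lerDl !addr_ge0.
have b2 : sn_bounded lyap (@cnorm R m) (@est_err R X p n m N xp).
  exists beta^-1; split=> [|z]; first by rewrite invr_ge0 ltW.
  rewrite mulrC ler_pdivlMr // mulrC.
  apply: (@le_trans _ _ (beta * nuE (est_err xp z))).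
    by rewrite ler_wpM2l ?(ltW be0) // cnorm_le_nuE.
  by rewrite /lyap -!addrA addrCA lerDl !addr_ge0.
have b3 : sn_bounded lyap (@rnorm R X) (@stable_err R X p n m N G b xp).
  exists gamma^-1; split=> [|z]; first by rewrite invr_ge0 ltW.
  rewrite mulrC ler_pdivlMr // mulrC.
  apply: (@le_trans _ _ (gamma * nuZ (stable_err G b xp z))).
    by rewrite ler_wpM2l ?(ltW ga0) // rnorm_le_nuZ.
  by rewrite /lyap addrAC lerDr !addr_ge0.
have b4 : sn_bounded lyap nuW (fun z => z.2.2).
  exists delta^-1; split=> [|z]; first by rewrite invr_ge0 ltW.
  by rewrite mulrC ler_pdivlMr // mulrC /lyap lerDr !addr_ge0.
have b5 j : sn_bounded lyap (@cnorm R p) (fun z => z.2.2 j).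
  apply: (sn_bounded_comp b4 (g := fun w : {ffun 'I_N.+1 -> U} => w j)).
  exists (sigma^-1 ^+ j); split=> [|w].
    by rewrite exprn_ge0 // invr_ge0 ltW.
  rewrite exprVn mulrC ler_pdivlMr ?exprn_gt0 // mulrC /nuW (bigD1 j) //= lerDl.
  apply: sumr_ge0 => i _; rewrite mulr_ge0 ?exprn_ge0 ?(ltW sg0) //.
  exact: sn_ge0 (@seminorm_cnorm R p) _.
have wfam (W : lmodType R[i]) (s : W -> R) (f : {linear {ffun 'I_N.+1 -> U} -> W}) :
    seminorm s -> sn_bounded lyap s (fun z => f z.2.2).
  move=> ss; apply: (sn_bounded_ext _ (sn_bounded_family f ss b5)) => z.
  by congr (f _); apply/ffunP => j; rewrite ffunE.
have bx : sn_bounded lyap (@rnorm R X) fst.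
  apply: (@sn_bounded_ext _ _ _ _ _ (fun z : Z => emb b (modes G xp res z).1
      + (stable_err G b xp z + recall G b xp z.2.2))).
    by move=> z; rewrite /stable_err subrK /stable_part addrC subrK.
  apply: sn_bounded_add => //.
    have fl : linear (fun s : S => emb b s.1).
      by move=> a x y; rewrite emb_linear.
    exact: (sn_bounded_comp b1 (sn_bounded_fin (bundle fl) sX)).
  apply: sn_bounded_add => //.
  exact: (wfam _ _ recall_lin sX).
have by1 : sn_bounded lyap (@fnorm R (E N)) (fun z => z.2).
  apply: (@sn_bounded_ext _ _ _ _ _ (fun z : Z => ((putx (modes G xp res z).1
      + - putx (est_err xp z)) + (putq (modes G xp res z).2
      + putq [ffun l => C (res l z.1)])) + putw z.2.2)).
    move=> [x [[c v] w]]; congr (_, _, _) => /=.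
    - by rewrite /est_err !addr0 opprB addrC subrK.
    - by apply/ffunP => l; rewrite !ffunE oppr0 !add0r addr0 subrK.
    - by rewrite oppr0 !addr0 add0r.
  apply: sn_bounded_add => //; last exact: (wfam _ _ (bundle putw_linear) sF).
  apply: sn_bounded_add => //; apply: sn_bounded_add => //.
  - have fl : linear (fun s : S => putx s.1).
      by move=> a x y; rewrite putx_linear.
    exact: (sn_bounded_comp b1 (sn_bounded_fin (bundle fl) sF)).
  - apply: sn_bounded_opp => //.
    exact: (sn_bounded_comp b2 (sn_bounded_column (bundle putx_linear) sF)).
  - have fl : linear (fun s : S => putq s.2).
      by move=> a x y; rewrite putq_linear.
    exact: (sn_bounded_comp b1 (sn_bounded_fin (bundle fl) sF)).
  - apply: (sn_bounded_family (bundle putq_linear)) => // l.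
    exact: (sn_bounded_comp bx
      (sn_bounded_comp (res_bd l) (sn_bounded_bop_col C))).
case: bx => c1 [c10 h1]; case: by1 => c2 [c20 h2].
exists (c1 + c2); split; first exact: addr_ge0.
by move=> z; rewrite mulrDl; apply: lerD; [exact: h1 | exact: h2].
Qed.

End Lyapunov.

Lemma iter_nuZ k x : Xm x -> Xm (iter k A x) /\ nuZ (iter k A x) <= r ^+ k * nuZ x.
Proof.
move=> Xx; elim: k => [|k [IH1 IH2]]; first by rewrite mul1r.
split; first exact: XmA.
by rewrite exprS -mulrA (le_trans (nuZ_contracts IH1)) // ler_wpM2l // ltW.
Qed.

Lemma Xm_recall N (w : {ffun 'I_N.+1 -> U}) : Xm (recall G b xp w).
Proof.
have [X0 XP] := Xm_lin; rewrite /recall; elim/big_ind: _ => // [x y Xx Xy|j _].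
  by rewrite -[x]scale1r; apply: XP.
exact: (iter_nuZ j (stable_partX _)).1.
Qed.

(** The gains a_i and k_i are those of N-independent maps.  The register length
    N enters only through the coupling cB * r^(N+1) * sigma^-N from the register
    to the stable error, which tends to 0 because r < sigma. *)
Lemma loop_decay : exists (N : nat) (c mu : R), [/\ 0 <= c, 0 < mu < 1 &
  forall k (z : X * E N),
    znorm (iter k (loop G b xp lam res Ap Bp L K) z) <= c * mu ^+ k * znorm z].
Proof.
have sZ := seminorm_nuZ; have sS := seminorm_nuS; have sE := seminorm_nuE.
have sc := @seminorm_cnorm R p.
have [a1 [a2 [a10 a20 Ha12]]] := mismatch_bound (bundle modal_input_lin \o K) sS.
have [a3 [a30 Ha3]] : sn_bounded nuZ nuE (fun x => L *m C x).
  apply: (sn_bounded_le rnorm_le_nuZ).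
  exact: (sn_bounded_comp (sn_bounded_bop_col C) (sn_bounded_column (mulmx L) sE)).
have [k1 [k10 Hk1]] : sn_bounded nuS (@cnorm R p) K.
  apply: (@sn_bounded_le _ _ _ (@fnorm R S)); last exact: sn_bounded_fin.
  by move=> s; exact: (adapted_ge (bundle cl_modes_linear) (seminorm_fnorm _) r0 (ltn0Sn kK)).
have [k2 [k3 [k20 k30 Hk23]]] := mismatch_bound K sc.
have [cB [cB0 HcB]] : sn_bounded (@cnorm R p) nuZ (fun u => stable_part b xp (B u)).
  exact: (sn_bounded_column (bundle (stable_part_linear b xp) \o B) sZ).
pose sigma := (1 + r) / 2; pose mu := (1 + sigma) / 2.
case/andP: (r01) => rp r1.
have rs : r < sigma by rewrite /sigma; lra.
have s1 : sigma < 1 by rewrite /sigma; lra.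
have sm : sigma < mu by rewrite /mu; lra.
have m1 : mu < 1 by rewrite /mu; lra.
have sp : 0 < sigma by lra.
have rsm : r < sigma < mu by rewrite rs.
have [beta [gamma [delta [eps [be0 ga0 de0 [ep0 HV]]]]]] :=
  lyapunov_weights a10 a20 a30 k10 k20 k30 rsm.
have q01 : 0 <= r / sigma < 1.
  by rewrite divr_ge0 ?(ltW rp) ?(ltW sp) //= ltr_pdivrMr // mul1r.
have e0 : 0 < eps / (cB * r + 1).
  by rewrite divr_gt0 // ltr_wpDl // mulr_ge0 // ltW.
have [N HN] := exprn_lt_eventually q01 e0.
have {HN} Hsmall : cB * r ^+ N.+1 * sigma^-1 ^+ N <= eps.
  have := HN N (leqnn _); rewrite ltr_pdivlMr; last by rewrite ltr_wpDl // mulr_ge0 // ltW.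
  move=> /ltW; apply: le_trans.
  rewrite exprS expr_div_n exprVn.
  have -> : cB * (r * r ^+ N) / sigma ^+ N = r ^+ N / sigma ^+ N * (cB * r) by ring.
  rewrite ler_wpM2l ?lerDl // divr_ge0 // exprn_ge0 // ltW //.
exists N.
have [c1 [c10 H1]] := znorm_le_lyap N sp be0 ga0 de0.
have [c2 [c20 H2]] := lyap_le_znorm N sp be0 ga0 de0.
exists (c1 * c2), mu; split; first exact: mulr_ge0.
  by rewrite m1 andbT; lra.
move=> k z; set lp := loop _ _ _ _ _ _ _ _ _.
have step z' : lyap sigma beta gamma delta (lp z') <= mu * lyap sigma beta gamma delta z'.
  have uE := ctl_outE G b xp res K z'; set u := ctl_out _ _ _ _ _ _ in uE.
  set s := modes _ _ _ _ in uE; set e := est_err _ _ in uE.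
  set x := stable_err _ _ _ _ in uE.
  have Xx : Xm x.
    have [X0 XP] := Xm_lin; rewrite /x /stable_err addrC -scaleN1r.
    by apply: XP; [exact: Xm_recall | exact: stable_partX].
  apply: HV; rewrite ?(sn_ge0 sS) ?(sn_ge0 sE) ?(sn_ge0 sZ) //.
  - exact: sn_ge0 (seminorm_nuW N sp) _.
  - rewrite /lp (modes_loop b L K xpA xpB resA HE) -/s -/u uE.
    have -> v w : modal_input Bp H (v + w) = modal_input Bp H v + modal_input Bp H w.
      by have := modal_input_lin 1 v w; rewrite !scale1r.
    rewrite addrA -/(cl_modes s).
    rewrite (le_trans (sn_add sS _ _)) // -addrA lerD ?nuS_contracts //.
    exact: Ha12.
  - rewrite /lp (est_err_loop lam res L K xpA xpB CE) -/e -/x.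
    by rewrite (le_trans (sn_add sE _ _)) // lerD ?nuE_contracts //.
  - rewrite /lp (stable_err_loop lam res Bp L K embA xpA) -/x.
    rewrite (le_trans (sn_add sZ _ _)) // lerD ?nuZ_contracts //.
    apply: le_trans (iter_nuZ _ (stable_partX _)).2 _.
    apply: (@le_trans _ _ (r ^+ N.+1 * (cB * (sigma^-1 ^+ N * nuW sigma z'.2.2)))).
      rewrite ler_wpM2l ?exprn_ge0 ?(ltW rp) // (le_trans (HcB _)) //.
      by rewrite ler_wpM2l // nuW_last.
    have -> : r ^+ N.+1 * (cB * (sigma^-1 ^+ N * nuW sigma z'.2.2)) =
      cB * r ^+ N.+1 * sigma^-1 ^+ N * nuW sigma z'.2.2 by ring.
    by rewrite ler_wpM2r // (sn_ge0 (seminorm_nuW N sp)).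
  - have -> : (lp z').2.2 = shift u z'.2.2 by rewrite /= addr0.
    rewrite (le_trans (nuW_shift sp _ _)) // lerD2r uE.
    rewrite (le_trans (sn_add sc _ _)) // -addrA lerD //.
have dec : lyap sigma beta gamma delta (iter k lp z) <= mu ^+ k * lyap sigma beta gamma delta z.
  elim: (k) => [|j IH]; first by rewrite mul1r.
  by rewrite exprS -mulrA (le_trans (step _)) // ler_wpM2l //; lra.
rewrite (le_trans (H1 _)) // -!mulrA ler_wpM2l // (le_trans dec) //.
by rewrite mulrCA ler_wpM2l // exprn_ge0 //; lra.
Qed.

End Stability.

(** * Realization of the controller *)

Section MatrixOf.
Variables (F : fieldType) (m q : nat) (f : {linear 'cV[F]_q -> 'cV[F]_m}).
Definition mx_of : 'M[F]_(m, q) := \matrix_(i, j) f (delta_mx j 0) i 0.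
Lemma mx_ofE u : f u = mx_of *m u.
Proof.
rewrite {1}[u]matrix_sum_delta; apply/matrixP => i j; rewrite ord1.
rewrite linear_sum /= summxE !mxE; apply: eq_bigr => a _.
by rewrite big_ord1 linearZ /= !mxE mulrC.
Qed.
End MatrixOf.

Section Decomposition.
Variables (R : realType) (X : hilbertType R) (Xp Xm : set X) (m : nat) (b : 'I_m -> X).
Hypotheses (Xb : is_basis Xp b) (Xs : direct_sum Xp Xm) (Xmc : closed_subspace Xm).

Let Xml : linear_set Xm := closed_subspace_linear Xmc.

Lemma emb_in c : Xp (emb b c).
Proof. by rewrite Xb.2 /=; exists (fun i => c i 0). Qed.

Lemma emb_inj c : emb b c = 0 -> c = 0.
Proof.
move=> h; have := Xb.1 (fun i => c i 0) h => h0.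
by apply/matrixP => i j; rewrite ord1 mxE h0.
Qed.

Lemma emb_Xm c : Xm (emb b c) -> c = 0.
Proof. by move=> h; apply: emb_inj; apply: Xs.2 => //; exact: emb_in. Qed.

Lemma coord_exists x : exists c, Xm (x - emb b c).
Proof.
have [v [w [Xv Xw ->]]] := Xs.1 x.
move: Xv; rewrite Xb.2 => -[c ->]; exists (\col_i c i).
rewrite (_ : emb b _ = \sum_i c i *: b i); first by rewrite addrC addKr.
by apply: eq_bigr => i _; rewrite mxE.
Qed.

(** Coordinates in the basis b of the component of x in Xp along Xm. *)
Definition coord x : 'cV[R[i]]_m := projT1 (cid (coord_exists x)).
Lemma coordP x : Xm (x - emb b (coord x)).
Proof. exact: (projT2 (cid (coord_exists x))). Qed.

Lemma coord_unique x c : Xm (x - emb b c) -> coord x = c.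
Proof.
move=> h; apply/eqP; rewrite -subr_eq0; apply/eqP/emb_Xm.
have -> : emb b (coord x - c) = (-1) *: (x - emb b (coord x)) + (x - emb b c).
  by rewrite -[coord x - c]addrC -scaleN1r emb_linear !scaleN1r; abel.
by apply: Xml.2 => //; exact: coordP.
Qed.

Lemma coord_linear : linear coord.
Proof.
move=> a x y; apply: coord_unique; rewrite emb_linear.
have -> : a *: x + y - (a *: emb b (coord x) + emb b (coord y)) =
   a *: (x - emb b (coord x)) + (y - emb b (coord y)).
  by rewrite scalerDr scalerN; abel.
by apply: Xml.2; exact: coordP.
Qed.

Lemma coord_emb c : coord (emb b c) = c.
Proof. by apply: coord_unique; rewrite subrr; exact: Xml.1. Qed.

Lemma coord_Xm x : Xm x -> coord x = 0.
Proof.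
move=> Xx; apply: coord_unique.
by rewrite (_ : emb b 0 = 0) ?subr0 // /emb big1 // => i _; rewrite mxE scale0r.
Qed.

Lemma emb_coord x : Xp x -> emb b (coord x) = x.
Proof.
rewrite Xb.2 => -[c xE]; have {}xE : x = emb b (\col_i c i).
  by rewrite xE; apply: eq_bigr => i _; rewrite mxE.
by rewrite {1}xE coord_emb -xE.
Qed.

Lemma coord_bounded : sn_bounded (@rnorm R X) (@cnorm R m) coord.
Proof.
have [|M [M0 HM]] := independent_coord_bound (b := b) Xml (closed_approx Xmc.2).
  move=> c h i; have := @emb_Xm (\col_i c i).
  rewrite (_ : emb b _ = \sum_i c i *: b i); last first.
    by apply: eq_bigr => j _; rewrite mxE.
  by move=> /(_ h) /matrixP/(_ i 0); rewrite !mxE.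
exists (\sum_(i < m) M); split; first by apply: sumr_ge0.
move=> x; rewrite mulr_suml; apply: ler_sum => i _.
have := HM _ (fun i => coord x i 0) i (coordP x).
by rewrite -/(emb b _) subrK.
Qed.

Lemma proj_coord x : coord (proj_along Xp Xm x) = coord x.
Proof.
rewrite /proj_along; case: xgetP => [v _ [Xv Xxv]|]; last first.
  by move=> /(_ (emb b (coord x))) []; split; [exact: emb_in | exact: coordP].
by apply/esym/coord_unique; rewrite emb_coord.
Qed.

End Decomposition.

(** The resolvent provided by [resolvent_set], as a linear map; it agrees with
    [resolvent], which picks the solution of the resolvent equation. *)
Lemma resolvent_linear (R : realType) (X : hilbertType R) (T : X -> X) z :
  resolvent_set T z -> exists S : {linear X -> X},
    [/\ sn_bounded (@rnorm R X) (@rnorm R X) S,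
        forall x, S (z *: x - T x) = x & forall x, resolvent T z x = S x].
Proof.
move=> [S [_ Slin [M HM] h1 h2]].
have Sl : linear S by move=> a x y; apply: Slin; rewrite inE.
exists (bundle Sl); split=> [|x|x]; last 1 first.
- rewrite /resolvent; case: xgetP => [y _ <-|]; first by rewrite bundleE h1.
  by move=> /(_ (S x)) []; exact: h2.
- exists (Num.max M 0); split; first by rewrite le_max lexx orbT.
  move=> x; apply: le_trans (HM x I) _.
  by rewrite ler_wpM2r ?rnorm_ge0 // le_max lexx.
- exact: h1.
Qed.

Lemma transferE (R : realType) (X : hilbertType R) (p n : nat) (G : plant X p n) z
    (S : {linear X -> X}) : (forall x, resolvent (plA G) z x = S x) ->
  forall u, transfer G z *m u = plC G (S (plB G u)) + plD G *m u.
Proof.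
move=> SE u; rewrite /transfer mulmxDl; congr (_ + _).
rewrite -[RHS]/((plC G \o S \o plB G) u) [RHS]mx_ofE; congr (_ *m u).
by apply/matrixP => i j; rewrite !mxE SE.
Qed.

Section ControllerOps.
Variables (R : realType) (X : hilbertType R) (p n m N : nat).
Variables (G : plant X p n) (b : 'I_m -> X) (xp : {linear X -> 'cV[R[i]]_m}).
Variables (lam : 'I_n -> R[i]) (res : 'I_n -> {linear X -> X}).
Variables (Ap : 'M[R[i]]_m) (Bp : 'M[R[i]]_(m, p)) (L : 'M[R[i]]_(m, p)).
Local Notation U := 'cV[R[i]]_p.
Local Notation S := ('cV[R[i]]_m * {ffun 'I_n -> U})%type.
Local Notation E := (S * {ffun 'I_N.+1 -> U})%type.
Variable K : {linear S -> U}.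
Local Notation Xd := (ell2 R 'I_(dim E)).

Let step_lin := bundle (ctl_step_linear G b xp lam res Ap Bp L K (N := N)).
Let in_lin := bundle (@ctl_in_linear R p n m N L).
Let out_lin := bundle (ctl_out_linear G b xp res K (N := N)).
Let P : {linear Xd -> Xd} := @enc R E \o step_lin \o @dec R E.
Let Q : {linear U -> Xd} := @enc R E \o in_lin.
Let O : {linear Xd -> U} := out_lin \o @dec R E.

(** The controller on the product of its three components, transported to a
    Euclidean space. *)
Definition observer_controller : controller Xd p := Controller
  (BoundedOp (@ell2_linear_continuous _ _ _ P))
  (BoundedOp (@linear_column_continuous _ _ _ Q))
  (BoundedOp (@ell2_linear_continuous _ _ _ O)).

Let Qsum (s : E) v : enc (s + ctl_in n N L v) = enc s + Q v.
Proof. exact: linearD. Qed.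

Lemma closed_loop_loop x (f : Xd) :
  closed_loop_op G observer_controller (x, f) =
  let z := loop G b xp lam res Ap Bp L K (x, dec f) in (z.1, enc z.2).
Proof.
congr (_, _).
rewrite [RHS]Qsum [Q (- _)]linearN [Q (_ + _)]linearD opprD.
exact: addrCA.
Qed.

Lemma closed_loop_iter k x (f : Xd) :
  iter k (closed_loop_op G observer_controller) (x, f) =
  let z := iter k (loop G b xp lam res Ap Bp L K) (x, dec f) in (z.1, enc z.2).
Proof.
elim: k => [|k IH] /=; first by rewrite decK.
rewrite IH /=; move: (iter k _ (x, dec f)) => [x' y'].
by rewrite closed_loop_loop /= encK.
Qed.

(** The l-th component of the equation is lam_l q_l = lam_l q_l + e. *)
Lemma observer_controller_internal_model l (f : Xd) (e : U) :
  lam l *: f = ctP observer_controller f + ctQ observer_controller e -> e = 0.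
Proof.
rewrite -[RHS](Qsum (ctl_step G b xp lam res Ap Bp L K (dec f))).
move=> /(congr1 (@dec R E)); rewrite encK linearZ.
move=> /(congr1 (fun y : E => y.1.2 l)) /=; rewrite !ffunE.
move=> /(congr1 (fun t => t - lam l *: (dec f).1.2 l)).
by rewrite subrr addrAC subrr add0r => <-.
Qed.
End ControllerOps.

Lemma observer_controller_stable (R : realType) (X : hilbertType R) (p n m N : nat)
    (G : plant X p n) (b : 'I_m -> X) (xp : {linear X -> 'cV[R[i]]_m})
    (lam : 'I_n -> R[i]) (res : 'I_n -> {linear X -> X})
    (Ap : 'M[R[i]]_m) (Bp : 'M[R[i]]_(m, p)) (L : 'M[R[i]]_(m, p))
    (K : {linear ('cV[R[i]]_m * {ffun 'I_n -> 'cV[R[i]]_p})%type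
      -> 'cV[R[i]]_p}) (c mu : R) :
  0 <= c -> 0 < mu < 1 ->
  (forall k z, znorm (N := N) (iter k (loop G b xp lam res Ap Bp L K) z)
     <= c * mu ^+ k * znorm z) ->
  closed_loop_stable G (@observer_controller R X p n m N G b xp lam res Ap Bp L K).
Proof.
move=> c0 mu01 h; apply/closed_loop_stableP.
exists c, mu; split=> // k [x f].
have e : znorm (x, dec f) = sum_norm (x, f) by rewrite /znorm /fnorm decK.
rewrite -e closed_loop_iter; exact: h.
Qed.

(** * Robust output regulation *)

Unset Implicit Arguments.

Theorem theorem2p5 (R : realType) (X : hilbertType R) (p n : nat)
    (G : plant X p n) (theta : 'I_n -> R) (Xp Xm : set X)
    (X_separable : separable X)
    (theta_range : forall l, 0 <= theta l < 2 * pi)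
    (theta_inj : injective theta)
    (a1 : forall l, resolvent_set (plA G) (expi (theta l)))
    (a2 : forall l, \det (transfer G (expi (theta l))) != 0)
    (a3 : [/\ closed_subspace Xp, closed_subspace Xm, finite_dim Xp &
              direct_sum Xp Xm])
    (a4 : maps_into_self (plA G) Xp /\ maps_into_self (plA G) Xm)
    (a5 : [/\ finite_set (spectrum (plA G) `&` closure (exterior 1)),
              (forall z, (spectrum (plA G) `&` closure (exterior 1)) z ->
                 is_eigenvalue (plA G) z /\ finite_alg_mult (plA G) z),
              spectrum_on Xp (plA G) =
                spectrum (plA G) `&` closure (exterior 1) &
              exists eta0 : R, 0 < eta0 < 1 /\
                spectrum_on Xm (plA G) =
                  spectrum (plA G) `&` ~` closure (exterior eta0)])
    (a6 : controllable Xp (plA G) (fun w => proj_along Xp Xm (plB G w)) /\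
          observable Xp (plA G) (plC G))
    (a7 : forall q, is_char_poly Xp (plA G) q -> simple_zeros q) :
  exists (Xd : hilbertType R) (K : controller Xd p),
    finite_dim [set: Xd] /\ solves_robust_regulation G K (exosystem_mx theta).
Proof.
have [_ Xmc [m [b Xb]] Xs] := a3.
have [ApXp AXm] := a4.
have Xml := closed_subspace_linear Xmc.
pose lam l := expi (theta l) : R[i].
pose xp := bundle (coord_linear Xb Xs Xmc).
pose E := bundle (emb_linear b).
pose Ap := mx_of (xp \o plA G \o E).
pose Bp := mx_of (xp \o plB G).
pose Cp := mx_of (plC G \o E).
have ApE c : xp (plA G (emb b c)) = Ap *m c by exact: (mx_ofE (xp \o plA G \o E)).
have embA c : plA G (emb b c) = emb b (Ap *m c).
  rewrite -ApE; apply/esym/(emb_coord Xb Xs Xmc); apply: ApXp; exact: emb_in Xb _.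
have xpA x : xp (plA G x) = Ap *m xp x.
  have -> : plA G x = plA G (x - emb b (xp x)) + plA G (emb b (xp x)).
    by rewrite -linearD subrK.
  rewrite [xp (_ + _)]linearD ApE [X in X + _](coord_Xm Xb Xs Xmc) ?add0r //.
  by apply: AXm; exact: coordP.
have xpB u : xp (plB G u) = Bp *m u by exact: (mx_ofE (xp \o plB G)).
have CE c : plC G (emb b c) = Cp *m c by exact: (mx_ofE (plC G \o E)).
have /choice [res Hres] := fun l => resolvent_linear (a1 l).
have resA l x : res l (lam l *: x - plA G x) = x by have [_ h _] := Hres l.
pose H l := transfer G (lam l).
have HE l u : H l *m u = plC G (res l (plB G u)) + plD G *m u.
  by apply: transferE; have [_ _ h] := Hres l.
have H_unit l : H l \in unitmx by rewrite unitmxE unitfE; exact: a2.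
have emb0 : emb b 0 = 0 by rewrite /emb big1 // => i _; rewrite mxE scale0r.
have Aiter k c : iter k (plA G) (emb b c) = emb b (iter k (mulmx Ap) c).
  by elim: k => //= k ->; rewrite embA.
have [ctrl obs] := a6.
have [L [kL nilL]] : exists (L : 'M[R[i]]_(m, p)) (k : nat),
    forall x : 'cV_m, iter k (mulmx (Ap + L *m Cp)) x = 0.
  apply: deadbeat_observer => c hc; apply: (emb_inj Xb); rewrite -emb0.
  apply: obs; [exact: emb_in Xb _ | exact: emb_in Xb _ |] => k.
  rewrite !Aiter !CE hc; elim: k => [|k IH]; first by rewrite mulmx0.
  rewrite (_ : iter k.+1 _ 0 = 0) ?mulmx0 //.
  by elim: k.+1 => //= j ->; rewrite mulmx0.
have reach : forall x1 : 'cV[R[i]]_m, exists (N : nat) (x : nat -> 'cV[R[i]]_m)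
    (u : nat -> 'cV[R[i]]_p),
   [/\ x 0%N = 0, forall k : nat, x k.+1 = Ap *m x k + Bp *m u k & x N = x1].
  move=> c; have X0 : Xp 0 by rewrite -emb0; exact: emb_in Xb _.
  have [N [x [u [x0 xS xN]]]] := ctrl 0 (emb b c) X0 (emb_in Xb c).
  exists N, (fun k => xp (x k)), u; split; first by rewrite x0 linear0.
    by move=> k; rewrite xS linearD xpA -xpB [X in _ + X](proj_coord Xb Xs Xmc).
  by rewrite xN; exact: coord_emb.
have lam_inj : injective lam.
  by move=> i j /(expi_inj (theta_range i) (theta_range j)) /theta_inj.
have lamA l (c : 'cV[R[i]]_m) : Ap *m c = lam l *: c -> c = 0.
  move=> hc; apply: (emb_inj Xb); rewrite -(resA l (emb b c)) embA hc.
  by rewrite -[emb b (_ *: _)]/(E _) linearZ /= subrr linear0.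
have [K [kK nilK]] := deadbeat_modal_feedback reach lam_inj lamA H_unit.
have [_ _ _ [eta0 [eta01 specm]]] := a5.
have [M [r [M0 r01 decay]]] : exists M r, [/\ (0 < M)%N, 0 < r < 1 &
    forall x, Xm x -> rnorm (iter M (plA G) x) <= r ^+ M * rnorm x].
  apply: (spectral_decay Xml AXm eta01) => z hz; apply: contrapT => nz.
  have : spectrum_on Xm (plA G) z by [].
  (* |z| > eta0 puts z in the closure that a point of the spectrum avoids *)
  rewrite specm => -[_]; apply; apply: subset_closure.
  by rewrite /exterior /= cmodE ltcR.
have xp_bd := coord_bounded Xb Xs Xmc.
have res_bd l : sn_bounded (@rnorm R X) (@rnorm R X) (res l) by have [] := Hres l.
have stable_partX x : Xm (stable_part b xp x) by exact: coordP.
(* the register length N comes last: all the gains above are independent of it *)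
have [N [c [mu [c0 mu01 dec]]]] := loop_decay embA xpA xpB CE resA HE xp_bd res_bd
  AXm Xml stable_partX M0 r01 decay nilL nilK.
pose Kc := @observer_controller R X p n m N G b xp lam res Ap Bp L K.
have im l f e : expi (theta l) *: f = ctP Kc f + ctQ Kc e -> e = 0.
  exact: (@observer_controller_internal_model R X p n m N G b xp lam res Ap Bp L K l).
have st : closed_loop_stable G Kc by exact: observer_controller_stable c0 mu01 dec.
exists (ell2 R _), Kc; split; first exact: ell2_finite_dim.
have tr (G' : plant X p n) : closed_loop_stable G' Kc -> tracking G' Kc (exosystem_mx theta).
  exact: (internal_model_tracking im).
split; [exact: st | exact: tr | move=> G' st'; exact: tr].
Qed.
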